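(* Let $X\in\mathbb{R}^{n\times p}$ have i.i.d. entries $X_{ij}\sim\mathcal{N}(0,1/n)$. Let $\{F_t\}_{t\ge1}$ and $\{G_t\}_{t\ge0}$ be scalar functions $\mathbb{R}\to\mathbb{R}$ (applied entrywise to vectors) that are differentiable except at a finite number of points, and consider the AMP recursion $$s_t = XF_t(\beta_t) - \langle F_t'(\beta_t)\rangle\, G_{t-1}(s_{t-1}),\qquad \beta_{t+1} = X^\top G_t(s_t) - \langle G_t'(s_t)\rangle\, F_t(\beta_t),\qquad t\ge1,$$ with $G_0(s_0)=0$ and a given initial vector $F_1(\beta_1)\in\mathbb{R}^p$ (not depending on $X$). Then for any $1\le t\le \min\{n,p\}$ the AMP sequence admits the decomposition $$s_t=\sum_{k=1}^t\gamma_t^k\phi_k+\xi_t,\qquad \beta_{t+1}=\sum_{k=1}^t\alpha_t^k\psi_k+\zeta_t,$$ where (i) $\{\phi_k\}_{k=1}^t$ and $\{\psi_k\}_{k=1}^t$ are independent vectors with $\phi_k\overset{\text{i.i.d.}}{\sim}\mathcal{N}(0,\frac1n I_n)$ and $\psi_k\overset{\text{i.i.d.}}{\sim}\mathcal{N}(0,\frac1n I_p)$; (ii) the coefficient vectors $\gamma_t=[\gamma_t^k]_{1\le k\le t}\in\mathbb{R}^t$ and $\alpha_t=[\alpha_t^k]_{1\le k\le t}\in\mathbb{R}^t$ satisfy $\|\gamma_t\|_2=\|F_t(\beta_t)\|_2$ and $\|\alpha_t\|_2=\|G_t(s_t)\|_2$; (iii) the residual vectors satisfy $\xi_t\in\mathrm{span}\{G_1(s_1),\dots,G_{t-1}(s_{t-1})\}$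 and $\zeta_t\in\mathrm{span}\{F_1(\beta_1),\dots,F_t(\beta_t)\}$.
   Context: For a vector $x\in\mathbb{R}^m$ (with $m$ equal to $n$ or $p$) the paper uses the normalization $\langle x\rangle := \frac1n\sum_{i=1}^m x_i$ (always divided by $n$). Derivatives $F_t',G_t'$ are applied entrywise. The vectors $\phi_k,\psi_k$, the coefficients $\gamma_t,\alpha_t$ and residuals $\xi_t,\zeta_t$ are random quantities (they may depend on $X$ and possibly on additional independent auxiliary randomness); in particular the coefficients may be statistically dependent on $\{\phi_k\},\{\psi_k\}$. *)

(* Defs.v *)
From HB Require Import structures.
From mathcomp Require Import all_boot all_order all_algebra.
From mathcomp Require Import all_classical all_reals all_analysis.
Set Implicit Arguments. Unset Strict Implicit. Unset Printing Implicit Defensive.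
Import Order.TTheory GRing.Theory Num.Theory.
Local Open Scope classical_set_scope.
Local Open Scope ring_scope.

Section AMP.
Variable R : realType.

(* <x> := (1/n) sum_i x_i, always normalized by n (also for x in R^p) *)
Definition avg (n m : nat) (v : 'cV[R]_m) : R := n%:R^-1 * \sum_(i < m) v i 0.

Definition norm2 (m : nat) (v : 'cV[R]_m) : R := Num.sqrt (\sum_(i < m) v i 0 ^+ 2).

Definition emap (f : R -> R) (m : nat) (v : 'cV[R]_m) : 'cV[R]_m := map_mx f v.

Variables (n p : nat).
Variables (F dF G dG : nat -> R -> R) (beta1 : 'cV[R]_p).

Definition Gterm (k : nat) (s : 'cV[R]_n) : 'cV[R]_n :=
  if k == 0%N then 0 else emap (G k) s.

(* amp X k = (s_k, beta_{k+1}) for k >= 1;  amp X 0 = (0, beta_1) *)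
Fixpoint amp (X : 'M[R]_(n, p)) (k : nat) : 'cV[R]_n * 'cV[R]_p :=
  match k with
  | 0%N => (0, beta1)
  | k'.+1 =>
      let sp := (amp X k').1 in
      let b := (amp X k').2 in
      let s := X *m emap (F k'.+1) b - avg n (emap (dF k'.+1) b) *: Gterm k' sp in
      (s, X^T *m emap (G k'.+1) s - avg n (emap (dG k'.+1) s) *: emap (F k'.+1) b)
  end.

Definition amp_s (X : 'M[R]_(n, p)) (t : nat) : 'cV[R]_n := (amp X t).1.
Definition amp_beta (X : 'M[R]_(n, p)) (t : nat) : 'cV[R]_p := (amp X t.-1).2.

End AMP.

(* Mutual independence of a finite family of real random variables:
   product rule for all families of Borel sets (taking B i = setT for the
   indices not involved gives the product rule for every subfamily). *)
Definition mutually_independent {R : realType} {d : measure_display}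
  {Omega : measurableType d} (P : probability Omega R) (I : finType)
  (Y : I -> Omega -> R) : Prop :=
  forall B : I -> set R, (forall i, measurable (B i)) ->
    P [set w | forall i, B i (Y i w)] = (\prod_(i : I) P [set w | B i (Y i w)])%E.

(* Y has law N(m, s^2) (s = standard deviation) *)
Definition has_normal_law {R : realType} {d : measure_display}
  {Omega : measurableType d} (P : probability Omega R) (m s : R)
  (Y : Omega -> R) : Prop :=
  measurable_fun [set: Omega] Y /\
  forall A : set R, measurable A -> P [set w | A (Y w)] = normal_prob m s A.

(* Main.v *)
Require Import Defs.
From HB Require Import structures.
From mathcomp Require Import all_boot all_order all_algebra.
From mathcomp Require Import all_classical all_reals all_analysis.
From mathcomp Require Import measurable_realfun.
From mathcomp Require Import ring lra.
Import Order.TTheory GRing.Theory Num.Theory.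
Import HBNNSimple.
Local Open Scope classical_set_scope.
Local Open Scope ring_scope.

(** Reveal [X] one direction at a time.  Let [z_k] and [w_k] be the
    Gram-Schmidt directions of [F_1(beta_1), F_2(beta_2), ...] and
    [G_1(s_1), G_2(s_2), ...] (zero whenever the new vector is dependent on the
    previous ones), and let [A_k], [B_k] be the projections onto the orthogonal
    complements of their spans.  One keeps the identity
    [X = K_k + B_k Y_k A_k] where [K_k] is a function of the Gaussian vectors
    already revealed.  Round [k] exchanges the component of [Y] along [z_k] with
    a fresh Gaussian vector, which then holds [phi_k = Y z_k], and likewise
    [psi_k = Y^T w_k].  Each exchange is a product of reflections whose
    directions depend only on coordinates that it leaves fixed; such an adaptive
    reflection is a composition of three shears, so it preserves Lebesgue
    measure by Fubini, and being isometric it preserves the Gaussian law.  Hence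
    after all rounds the [phi_k], [psi_k] are still i.i.d. Gaussian.  Since
    [A_k F_k(beta_k) = 0] and [B_k G_k(s_k) = 0] once direction [k] is revealed,
    the iteration sees [K_k] only, and expanding [K_k] gives the decomposition
    with [gamma_t^k = z_k^T F_t(beta_t)], [alpha_t^k = w_k^T G_t(s_t)]. *)

(** * Normal and Lebesgue integrals on the real line *)

Section RealLine.
Context {R : realType}.
Implicit Types (f h : R -> \bar R) (s c e : R).

(** Simple functions reduce to the defining integral of [normal_prob]; monotone convergence on both
    sides then gives all nonnegative measurable [f]. *)
Lemma ge0_integral_normal_prob m s f :
  measurable_fun [set: R] f -> (forall x, 0 <= f x)%E ->
  (\int[normal_prob m s]_x f x =
   \int[lebesgue_measure]_x (f x * (normal_pdf m s x)%:E))%E.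
Proof.
move=> mf f0.
have mpdf : measurable_fun [set: R] (fun x => (normal_pdf m s x)%:E).
  by apply/measurable_EFinP; exact: measurable_normal_pdf.
have pdf0 x : (0 <= (normal_pdf m s x)%:E)%E by rewrite lee_fin normal_pdf_ge0.
pose f_ := nnsfun_approx measurableT mf.
have mf_ n : measurable_fun [set: R] (f_ n : R -> R).
  exact: (@measurable_funP _ _ _ _ _ (f_ n)).
have nd_ k n y : (k <= n)%N -> f_ k y <= f_ n y.
  by move=> kn; move/lefP: (nd_nnsfun_approx measurableT mf kn); exact.
have mp_ n r : measurable (f_ n @^-1` [set r]) by [].
have mi_ n r : measurable_fun [set: R] (fun x => (r * \1_(f_ n @^-1` [set r]) x)%:E).
  apply/measurable_EFinP; apply: measurable_funM; first exact: measurable_cst.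
  exact: measurable_indic.
have cvf x : (f_ n x)%:E @[n --> \oo] --> f x by exact: cvg_nnsfun_approx.
transitivity (limn (fun n => \int[normal_prob m s]_x (f_ n x)%:E))%E.
  rewrite -monotone_convergence//.
  - by apply: eq_integral => y _; apply/esym/cvg_lim.
  - by move=> n; apply/measurable_EFinP; exact: mf_.
  - by move=> n y _; rewrite lee_fin.
  - by move=> y _ k n kn; rewrite lee_fin; exact: nd_.
transitivity (limn (fun n => \int[lebesgue_measure]_x
    ((f_ n x)%:E * (normal_pdf m s x)%:E)))%E; last first.
  rewrite -monotone_convergence//.
  - apply: eq_integral => y _; apply/cvg_lim => //.
    by apply: cvgeZr.
  - move=> n; apply: emeasurable_funM => //.
    by apply/measurable_EFinP; exact: mf_.
  - by move=> n y _; rewrite mule_ge0// lee_fin.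
  - move=> y _ k n kn; rewrite lee_wpmul2r// lee_fin.
    exact: nd_.
congr (limn _); apply/funext => n.
under eq_integral do rewrite fimfunE -fsumEFin//.
under [in RHS]eq_integral.
  move=> x _; rewrite fimfunE -fsumEFin// ge0_mule_fsuml; last first.
    by move=> r; rewrite nnfun_muleindic_ge0.
  over.
rewrite ge0_integral_fsum//; last 2 first.
- by move=> r; exact: mi_.
- by move=> r x _; rewrite nnfun_muleindic_ge0.
rewrite ge0_integral_fsum//; last 2 first.
- by move=> r; apply: emeasurable_funM; [exact: mi_|exact: mpdf].
- by move=> r x _; rewrite mule_ge0// nnfun_muleindic_ge0.
apply: eq_fsbigr => r; rewrite inE => -[z _ zr].
have r0 : 0 <= r by rewrite -zr.
have mr : measurable (f_ n @^-1` [set r]) by [].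
under eq_integral do rewrite EFinM.
under [RHS]eq_integral do rewrite EFinM -muleA.
rewrite !ge0_integralZl//.
- rewrite integral_indic// setIT; congr (_ * _)%E.
  rewrite /normal_prob [LHS]integral_mkcond; apply: eq_integral => x _.
  by rewrite patchE indicE; case: ifPn => xr; rewrite ?mul1e ?mul0e.
- apply: emeasurable_funM; last exact: mpdf.
  by apply/measurable_EFinP; exact: measurable_indic.
- by move=> x _; rewrite mule_ge0// lee_fin.
- by apply/measurable_EFinP; exact: measurable_indic.
Qed.

(** The image of Lebesgue measure under a translation gives each half-open interval its length, so
    it is Lebesgue measure by uniqueness. *)
Lemma ge0_integral_lebesgue_shift (h : R -> \bar R) c :
  measurable_fun [set: R] h -> (forall x, 0 <= h x)%E ->
  (\int[lebesgue_measure]_x h (x + c)%R = \int[lebesgue_measure]_x h x)%E.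
Proof.
move=> mh h0; pose phi : R -> measurableTypeR R := fun x => x + c.
have mphi : measurable_fun [set: R] phi by exact: measurable_funD.
transitivity (\int[pushforward lebesgue_measure phi]_x h x)%E.
  by rewrite ge0_integral_pushforward//=; exact: in1W.
apply: eq_measure_integral => A mA _; apply/esym.
apply: lebesgue_measure_unique => //= _ [[a b]] _ <-.
rewrite /pushforward (_ : phi @^-1` _ = `](a - c), (b - c)]%classic).
  by rewrite /= !lebesgue_measure_itv/= !lte_fin ltrD2r -!EFinB; congr (if _ then _%:E else _); ring.
by apply/seteqP; split => x; rewrite /phi /= !in_itv/= ltrBlDr lerBrDr.
Qed.

Lemma ge0_integral_lebesgue_opp (h : R -> \bar R) :
  measurable_fun [set: R] h -> (forall x, 0 <= h x)%E ->
  (\int[lebesgue_measure]_x h (- x)%R = \int[lebesgue_measure]_x h x)%E.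
Proof.
move=> mh h0; pose phi : R -> measurableTypeR R := -%R.
have mphi : measurable_fun [set: R] phi by exact: oppr_measurable.
transitivity (\int[pushforward lebesgue_measure phi]_x h x)%E.
  by rewrite ge0_integral_pushforward//=; exact: in1W.
by apply: eq_measure_integral => A mA _; exact: lebesgue_measureN.
Qed.

(** Reciprocal of the density of N(0, s^2) up to a constant. Multiplying an integrand by it turns a
    normal integral into a Lebesgue one, so that Lebesgue measure can be handled through probability
    measures only. *)
Definition gauss_weight s (x : R) : \bar R := (expR (x ^+ 2 / (s ^+ 2 *+ 2)))%:E.

Lemma gauss_weight_ge0 s x : (0 <= gauss_weight s x)%E.
Proof. by rewrite lee_fin expR_ge0. Qed.

Lemma measurable_gauss_weight s : measurable_fun [set: R] (gauss_weight s).
Proof.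
apply/measurable_EFinP; apply: measurableT_comp => //.
by apply: measurable_funM => //; exact: measurable_funX.
Qed.

Lemma normal_gauss_weight s h : s != 0 ->
  measurable_fun [set: R] h -> (forall x, 0 <= h x)%E ->
  (\int[normal_prob 0 s]_x (h x * gauss_weight s x) =
   (normal_peak s)%:E * \int[lebesgue_measure]_x h x)%E.
Proof.
move=> s0 mh h0; rewrite ge0_integral_normal_prob//; last 2 first.
- by apply: emeasurable_funM => //; exact: measurable_gauss_weight.
- by move=> x; rewrite mule_ge0// gauss_weight_ge0.
rewrite -ge0_integralZl//; last by rewrite lee_fin normal_peak_ge0.
apply: eq_integral => x _; rewrite -muleA muleC; congr (_ * _)%E.
rewrite /gauss_weight -EFinM; congr (_%:E).
rewrite normal_pdfE// /normal_fun subr0 mulrCA -expRD.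
by rewrite mulNr subrr expR0 mulr1.
Qed.

(** This is the one-dimensional fibre of a shear: once the weight is absorbed, only the invariance
    of Lebesgue measure under translation and sign change remains. *)
Lemma normal_gauss_weight_affine s h e c : s != 0 -> (e = 1 \/ e = -1) ->
  measurable_fun [set: R] h -> (forall x, 0 <= h x)%E ->
  (\int[normal_prob 0 s]_x (h (e * x + c)%R * gauss_weight s x) =
   \int[normal_prob 0 s]_x (h x * gauss_weight s x))%E.
Proof.
move=> s0 he mh h0.
have maff k : measurable_fun [set: R] (fun x => h (k * x + c)).
  apply: (measurableT_comp mh (g := fun x => k * x + c)).
  apply: (@measurable_funD _ _ _ _ (fun x => k * x) (cst c)) => //.
  exact: mulrl_measurable.
rewrite !normal_gauss_weight//; congr (_ * _)%E.
rewrite -(ge0_integral_lebesgue_shift h c)//.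
case: he => ->.
  by apply: eq_integral => x _; rewrite mul1r.
rewrite -[RHS]ge0_integral_lebesgue_opp//.
- by apply: eq_integral => x _; rewrite mulN1r.
- by rewrite (_ : (fun x => _) = (fun x => h (1 * x + c)%R)) //; apply/funext => x; rewrite mul1r.
Qed.

End RealLine.

(** * Finite products of the real line and i.i.d. laws on them *)

Definition rects (I : finType) (R : realType) : set (set (I -> R)) :=
  [set A | exists2 B : I -> set R, (forall i, measurable (B i)) &
     A = [set x | forall i, B i (x i)]].

(** A separate name for [I -> R], to which the sigma-algebra generated by the measurable rectangles
    is attached. *)
Definition prodR (I : finType) (R : realType) : Type := I -> R.

HB.instance Definition _ (I : finType) (R : realType) :=
  gen_eqMixin (prodR I R).
HB.instance Definition _ (I : finType) (R : realType) :=
  gen_choiceMixin (prodR I R).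
HB.instance Definition _ (I : finType) (R : realType) :=
  isPointed.Build (prodR I R) (fun=> 0).
HB.instance Definition _ (I : finType) (R : realType) :=
  @isMeasurable.Build (sigma_display (rects I R)) (prodR I R)
    <<s (rects I R : set (set (prodR I R))) >>
    (@sigma_algebra0 _ setT (rects I R))
    (@sigma_algebraC (prodR I R) (rects I R))
    (@sigma_algebra_bigcup _ setT (rects I R)).

Definition upd {I : finType} {T : Type} (x : I -> T) (i : I) (y : T) : I -> T :=
  fun j => if j == i then y else x j.

Lemma pushforward_probability {R : realType} d1 d2 (T1 : measurableType d1)
    (T2 : measurableType d2) (P : probability T1 R) (f : T1 -> T2) :
  measurable_fun [set: T1] f ->
  exists Q : probability T2 R, forall A, Q A = P (f @^-1` A).
Proof.
move=> mf.
pose nu := measure_function_pushforward__canonical__measure_function_Measure P mf.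
have nuT : nu setT = 1%E.
  by rewrite /= /pushforward preimage_setT; exact: probability_setT.
pose nuP : probability T2 R := HB.pack (nu : set T2 -> \bar R) nu
  (Measure_isProbability.Build _ _ _ nu nuT).
by exists nuP.
Qed.

Lemma measurable_forall_preimage {R : realType} d (W : measurableType d) (I : finType)
    (f : I -> W -> R) (B : I -> set R) :
  (forall i, measurable_fun [set: W] (f i)) -> (forall i, measurable (B i)) ->
  measurable [set w | forall i, B i (f i w)].
Proof.
move=> mf mB.
rewrite (_ : [set w | _] = \bigcap_(i in [set: I]) (f i @^-1` B i)).
  apply: fin_bigcap_measurable => // i _.
  by rewrite -[X in measurable X]setTI; apply: mf => //; exact: mB.
by apply/seteqP; split=> w /= h i; [move=> _|]; exact: h.
Qed.

Section ProductSpace.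
Context {R : realType} {I : finType}.
Local Notation E := (prodR I R).

Lemma measurable_coord (i : I) : measurable_fun [set: E] (fun x => x i).
Proof.
move=> _ B mB; rewrite setTI; apply: sub_sigma_algebra.
exists (fun j => if j == i then B else setT).
  by move=> j; case: ifP.
apply/seteqP; split=> x /=.
  by move=> Bx j; case: eqP => [->|].
by move=> /(_ i); rewrite eqxx.
Qed.

Lemma measurable_tofun d (T : measurableType d) (f : T -> E) :
  (forall i, measurable_fun [set: T] (fun w => f w i)) ->
  measurable_fun [set: T] f.
Proof.
move=> mf; apply: (@measurability _ _ T E setT f (rects I R)) => //.
move=> _ [_ [B mB ->] <-]; rewrite setTI.
exact: (measurable_forall_preimage _ _ _ (fun i w => f w i) B).
Qed.

Lemma prodR_measure_unique (m1 m2 : probability E R) :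
  (forall A, rects I R A -> m1 A = m2 A) ->
  forall A, measurable A -> m1 A = m2 A.
Proof.
move=> m12; apply: (@measure_unique _ R E (rects I R) (fun=> setT)) => //.
- move=> _ _ [B mB ->] [C mC ->]; exists (fun i => B i `&` C i).
    by move=> i; apply: measurableI; [exact: mB|exact: mC].
  apply/seteqP; split=> x /=; first by move=> [xB xC] i; split.
  by move=> xBC; split=> i; case: (xBC i).
- move=> _; exists (fun=> setT) => //.
  by apply/seteqP; split.
- by rewrite bigcup_const.
- by move=> _; rewrite (le_lt_trans (probability_le1 _ _)) ?ltry.
Qed.

Lemma measurable_upd d (T : measurableType d) (f : T -> E) (i : I) (g : T -> R) :
  measurable_fun [set: T] f -> measurable_fun [set: T] g ->
  measurable_fun [set: T] (fun w => upd (f w) i (g w) : E).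
Proof.
move=> mf mg; apply: measurable_tofun => j; rewrite /upd.
by case: (j == i) => //; exact: (measurableT_comp (measurable_coord j) mf).
Qed.

Definition iid_law (N : set R -> \bar R) (mu : probability E R) :=
  forall B : I -> set R, (forall i, measurable (B i)) ->
    mu [set x | forall i, B i (x i)] = (\prod_(i : I) N (B i))%E.

(** Overwriting coordinate [i] by an independent draw from [N] preserves the law on rectangles,
    hence the law itself; Tonelli then separates the draw. This gives Fubini in one coordinate
    without splitting the product space. *)
Lemma iid_law_resample (N : probability (measurableTypeR R) R) (mu : probability E R) (i : I)
    (f : E -> \bar R) :
  iid_law N mu -> measurable_fun [set: E] f -> (forall x, 0 <= f x)%E ->
  (\int[mu]_x f x = \int[mu]_x \int[N]_y f (upd x i y))%E.
Proof.
move=> iid mf f0; pose phi (u : E * measurableTypeR R) : E := upd u.1 i u.2.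
have mphi : measurable_fun [set: E * measurableTypeR R] phi.
  by apply: measurable_upd; [exact: measurable_fst|exact: measurable_snd].
have [nuP nuE] := pushforward_probability _ _ _ _ [the probability _ _ of (mu \x N)%E] phi mphi.
have munu A : measurable A -> mu A = nuP A.
  apply: prodR_measure_unique => _ [B mB ->]; rewrite iid// nuE.
  (* The condition on coordinate [i] falls on the fresh variable, and the old coordinate [i] becomes
     unconstrained. *)
  rewrite (_ : _ @^-1` _ =
     [set x | forall j, (if j == i then setT else B j) (x j)] `*` B i).
    rewrite /= product_measure1E; last 2 first.
    - apply: sub_sigma_algebra; exists (fun j => if j == i then setT else B j) => //.
      by move=> j; case: ifP => // _; exact: mB.
    - exact: mB.
    have /= -> := iid (fun j => if j == i then setT else B j); last first.
      by move=> j; case: ifP => // _; exact: mB.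
    rewrite (bigD1 i)//= [in RHS](bigD1 i)//= eqxx probability_setT mul1e muleC.
    by congr (_ * _)%E; apply: eq_bigr => j /negPf ->.
  apply/seteqP; split=> [[x y]|[x y]]; rewrite /phi /upd /=.
    move=> h; split; last by have := h i; rewrite eqxx.
    by move=> j; case: ifP => // ji; have := h j; rewrite ji.
  by move=> [h yB] j; case: eqP => [->//|/eqP/negPf ji]; have := h j; rewrite ji.
transitivity (\int[pushforward (mu \x N)%E phi]_x f x)%E.
  apply: eq_measure_integral => A mA _.
  by have := munu A mA; rewrite nuE.
transitivity (\int[(mu \x N)%E]_v (f \o phi) v)%E.
  by rewrite (ge0_integral_pushforward mphi)//=; exact: in1W.
rewrite fubini_tonelli1; first by [].
  exact: measurableT_comp.
by move=> u; exact: f0.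
Qed.

End ProductSpace.

(** * Adaptive shears and Lebesgue measure *)

Section Shear.
Context {R : realType} {I : finType} {s : R} {mu : probability (prodR I R) R}.
Hypothesis s0 : s != 0.
Hypothesis iid : iid_law (normal_prob 0 s) mu.
Local Notation E := (prodR I R).

Definition sqnorm (x : I -> R) : R := \sum_i x i ^+ 2.

Definition prod_weight (x : I -> R) : \bar R :=
  (expR (sqnorm x / (s ^+ 2 *+ 2)))%:E.

Lemma measurable_prod_weight : measurable_fun [set: E] prod_weight.
Proof.
apply/measurable_EFinP; apply: measurableT_comp => //.
apply: (@measurable_funM _ E _ _ (fun x : E => sqnorm x) (cst _)) => //.
apply: measurable_sum => i.
by apply: measurable_funX; exact: measurable_coord.
Qed.

Lemma prod_weight_upd (x : I -> R) i y : prod_weight (upd x i y) =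
  (prod_weight (upd x i 0%R) * gauss_weight s y)%E.
Proof.
have nE : sqnorm (upd x i y) = sqnorm (upd x i 0) + y ^+ 2.
  rewrite /sqnorm (bigD1 i)//= [in RHS](bigD1 i)//= /upd eqxx expr0n/= add0r addrC.
  by congr (_ + _); apply: eq_bigr => j /negPf ->.
by rewrite /prod_weight nE mulrDl expRD EFinM.
Qed.

(* [prod_weight] is, up to a constant, the inverse of the density of [mu]: this says that [T] preserves Lebesgue measure. *)
Definition preserves_lebesgue (T : E -> E) := measurable_fun [set: E] T /\
  forall f : E -> \bar R, measurable_fun [set: E] f -> (forall x, 0 <= f x)%E ->
    (\int[mu]_x (f (T x) * prod_weight x) = \int[mu]_x (f x * prod_weight x))%E.

Lemma preserves_lebesgue_comp (T U : E -> E) :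
  preserves_lebesgue T -> preserves_lebesgue U ->
  preserves_lebesgue (T \o U).
Proof.
move=> [mT hT] [mU hU]; split; first exact: measurableT_comp.
move=> f mf f0; rewrite (hU (f \o T)) ?hT//; last by move=> x; exact: f0.
exact: measurableT_comp.
Qed.

(** Since [e] and [c] ignore coordinate [i], they are constants on each line in direction [i].
    Resampling that coordinate therefore leaves the affine change of variable [y] to [e y + c] with
    [e] equal to 1 or -1. *)
Lemma preserves_lebesgue_shear (i : I) (e c : E -> R) :
  measurable_fun [set: E] e -> measurable_fun [set: E] c ->
  (forall x, e x = 1 \/ e x = -1) ->
  (forall x y, e (upd x i y) = e x) -> (forall x y, c (upd x i y) = c x) ->
  preserves_lebesgue (fun x => upd x i (e x * x i + c x)).
Proof.
move=> me mc e1 eu cu.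
have mT : measurable_fun [set: E]
    (fun x : E => upd x i (e x * x i + c x) : E).
  apply: measurable_upd; first exact: measurable_id.
  apply: (@measurable_funD _ _ _ _ (fun x : E => e x * x i) c) => //.
  by apply: measurable_funM => //; exact: measurable_coord.
split=> // f mf f0.
have w0 x : (0 <= prod_weight x)%E by rewrite lee_fin expR_ge0.
have mw := measurable_prod_weight.
have mfT := measurableT_comp mf mT.
rewrite (iid_law_resample (normal_prob 0 s) _ i _ iid); last 2 first.
- exact: emeasurable_funM.
- by move=> x; rewrite mule_ge0.
rewrite [RHS](iid_law_resample (normal_prob 0 s) _ i _ iid); last 2 first.
- exact: emeasurable_funM.
- by move=> x; rewrite mule_ge0.
apply: eq_integral => x _.
pose h (y : R) := (f (upd x i y) * prod_weight (upd x i 0%R))%E.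
have mh : measurable_fun [set: R] h.
  apply: emeasurable_funM; last exact: measurable_cst.
  apply: (measurableT_comp mf (g := fun y => upd x i y : E)).
  by apply: measurable_upd; [exact: measurable_cst|exact: measurable_id].
transitivity (\int[normal_prob 0 s]_y (h (e x * y + c x)%R * gauss_weight s y))%E.
  apply: eq_integral => y _; rewrite prod_weight_upd eu cu /h -muleA.
  congr (f _ * _)%E.
  by apply/funext => j; rewrite /upd eqxx; case: (j == i).
rewrite (normal_gauss_weight_affine s h (e x) (c x) s0 (e1 x) mh); last first.
  by move=> y; rewrite mule_ge0.
by apply: eq_integral => y _; rewrite prod_weight_upd muleA.
Qed.

(** The invariance is applied to the indicator of [A] divided by the weight. The weight depends on
    [sqnorm] only, so it takes the same value at [x] and [T x] and cancels on both sides. *)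
Lemma preserves_lebesgue_isometry (T : E -> E) : preserves_lebesgue T ->
  (forall x, sqnorm (T x) = sqnorm x) ->
  forall A, measurable A -> mu (T @^-1` A) = mu A.
Proof.
move=> [mT hT] nT A mA.
have mTA : measurable (T @^-1` A) by rewrite -[X in measurable X]setTI; exact: mT.
pose f (x : E) : \bar R :=
  ((\1_A x)%:E * (expR (- (sqnorm x / (s ^+ 2 *+ 2))))%:E)%E.
have fw x : (f x * prod_weight x = (\1_A x)%:E)%E.
  by rewrite /f /prod_weight -!EFinM -mulrA -expRD addNr expR0 mulr1.
have fTw x : (f (T x) * prod_weight x = (\1_(T @^-1` A) x)%:E)%E.
  by rewrite /f /prod_weight nT -!EFinM -mulrA -expRD addNr expR0 mulr1.
have mf : measurable_fun [set: E] f.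
  apply: emeasurable_funM; first by apply/measurable_EFinP; exact: measurable_indic.
  apply/measurable_EFinP; apply: measurableT_comp => //.
  apply: (@measurable_funN _ E R _ (fun x : E => sqnorm x / (s ^+ 2 *+ 2))) => //.
  apply: (@measurable_funM _ E _ _ (fun x : E => sqnorm x) (cst _)) => //.
  apply: measurable_sum => i.
  by apply: measurable_funX; exact: measurable_coord.
have f0 x : (0 <= f x)%E by rewrite mule_ge0// lee_fin ?expR_ge0.
have := hT f mf f0.
under eq_integral do rewrite fTw.
under [in RHS]eq_integral do rewrite fw.
by rewrite !integral_indic// !setIT.
Qed.

End Shear.
Arguments preserves_lebesgue {R I} s mu T.

(** * Reflections in directions that depend on the fixed coordinates *)

Section Reflections.
Context {R : realType} {I : finType} {s : R} {mu : probability (prodR I R) R}.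
Hypothesis s0 : s != 0.
Hypothesis iid : iid_law (normal_prob 0 s) mu.
Local Notation E := (prodR I R).

Definition dotp (u x : I -> R) : R := \sum_i u i * x i.

Lemma dotpBr_sum (J : Type) (r : seq J) (a : J -> R) (w : J -> I -> R)
    (u x : I -> R) :
  dotp u (fun c => x c - \sum_(l <- r) a l * w l c) =
  dotp u x - \sum_(l <- r) a l * dotp u (w l).
Proof.
rewrite /dotp; under eq_bigr do rewrite mulrBr.
rewrite sumrB; congr (_ - _).
under eq_bigr do rewrite mulr_sumr.
rewrite exchange_big/=; apply: eq_bigr => l _.
by rewrite mulr_sumr; apply: eq_bigr => i _; rewrite mulrCA.
Qed.

(** With squared length 2, the usual factor [2 / sqnorm v] of a reflection is 1; the zero vector
    gives the identity. *)
Lemma sqnorm_reflection (v x : I -> R) :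
  v = (fun=> 0) \/ sqnorm v = 2 ->
  sqnorm (fun c => x c - dotp v x * v c) = sqnorm x.
Proof.
have key d : sqnorm (fun c => x c - d * v c) =
    sqnorm x - d * (2 * dotp v x - d * sqnorm v).
  rewrite /sqnorm /dotp 2!mulr_sumr -sumrB mulr_sumr -sumrB.
  by apply: eq_bigr => i _; ring.
move=> hv; rewrite key.
case: hv => [v0|->]; last by ring.
have -> : dotp v x = 0 by rewrite /dotp big1// => i _; rewrite v0 mul0r.
by rewrite mul0r subr0.
Qed.

Section OneReflection.
Variables (H : pred I) (v : E -> I -> R) (i0 : I).
Hypothesis mv : forall i, measurable_fun [set: E] (fun x => v x i).
Hypothesis vH : forall x y : E, (forall i, ~~ H i -> x i = y i) -> v x = v y.
Hypothesis suppv : forall x i, ~~ H i -> v x i = 0.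
Hypothesis Hi0 : H i0.
Hypothesis v2 : forall x, v x = (fun=> 0) \/ v x i0 = -1 /\ sqnorm (v x) = 2.

Let vupd (x : E) i y : H i -> v (upd x i y) = v x.
Proof.
move=> Hi; apply: vH => j Hj; rewrite /upd; case: eqP => // ji.
by rewrite ji Hi in Hj.
Qed.

Let rest (x : E) : R := \sum_(j | j != i0) v x j * x j.

Let mrest : measurable_fun [set: E] rest.
Proof.
rewrite /rest (_ : (fun x => _) = fun x : E => \sum_j (if j != i0 then v x j * x j else 0)).
  apply: measurable_sum => j; case: (j != i0) => //.
  by apply: measurable_funM => //; exact: measurable_coord.
by apply/funext => x; rewrite big_mkcond.
Qed.

Let restupd (x : E) y : rest (upd x i0 y) = rest x.
Proof.
by rewrite /rest vupd//; apply: eq_bigr => j /negPf ji; rewrite /upd ji.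
Qed.

Let shears (r : seq I) (x : E) : E :=
  fun c => x c + (c \in r)%:R * (x i0 * v x c).

Let shears_preserve (r : seq I) : uniq r -> all H r -> i0 \notin r ->
  preserves_lebesgue s mu (shears r).
Proof.
elim: r => [_ _ _|j r IHr /= /andP[jr ur] /andP[Hj Hr]].
  rewrite (_ : shears _ = id); first by split.
  by apply/funext => x; apply/funext => c; rewrite /shears mul0r addr0.
rewrite inE negb_or => /andP[i0j i0r].
pose sh (x : E) : E := upd x j (1 * x j + x i0 * v x j).
have -> : shears (j :: r) = sh \o shears r.
  apply/funext => x; have vr : v (shears r x) = v x.
    apply: vH => i Hi; rewrite /shears; case: (boolP (i \in r)) => ir.
      by rewrite (allP Hr _ ir) in Hi.
    by rewrite mul0r addr0.
  apply/funext => c; rewrite /sh /= /upd vr /shears in_cons (negPf i0r).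
  rewrite mul0r addr0 mul1r; case: eqP => [->|_] /=; last by [].
  by rewrite (negPf jr) mul0r addr0 mul1r.
apply: preserves_lebesgue_comp; last exact: IHr.
apply: (preserves_lebesgue_shear s0 iid j (fun=> 1) (fun x => x i0 * v x j)) => //.
- by apply: measurable_funM => //; exact: measurable_coord.
- by left.
- by move=> x y; rewrite vupd// /upd (negPf i0j).
Qed.

(** Three shears suffice when [v] has entry -1 at the pivot [i0]. [S1] stores [- dotp v x] in the
    pivot; [shears] adds this multiple of [v] to the other coordinates of [H]; [S3] gives the pivot
    its reflected value, which is [rest x]. The direction [v] stays the same throughout, as it reads
    only coordinates outside [H]. *)
Lemma preserves_lebesgue_reflection :
  preserves_lebesgue s mu (fun x c => x c - dotp (v x) x * v x c).
Proof.
pose r := [seq j <- enum I | H j && (j != i0)].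
pose S1 (x : E) : E := upd x i0 (1 * x i0 + - rest x).
(* The coefficient [1 + 2 * v x i0] is -1 for a true reflection and 1 when [v x] vanishes, so one
   formula covers both cases. *)
pose S3 (x : E) : E := upd x i0 ((1 + 2 * v x i0) * x i0 + rest x).
have rE c : (c \in r) = H c && (c != i0) by rewrite mem_filter mem_enum andbT.
have -> : (fun x c => x c - dotp (v x) x * v x c) = S3 \o (shears r \o S1).
  apply/funext => x; pose x1 := S1 x; pose x2 := shears r x1.
  have v1 : v x1 = v x by exact: vupd.
  have vv2 : v x2 = v x.
    rewrite -v1; apply: vH => i Hi.
    by rewrite /x2 /shears rE (negPf Hi) mul0r addr0.
  have x10 : x1 i0 = x i0 - rest x by rewrite /x1 /S1 /upd eqxx mul1r.
  have x1c c : c != i0 -> x1 c = x c by move=> /negPf ci; rewrite /x1 /S1 /upd ci.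
  have x20 : x2 i0 = x i0 - rest x.
    by rewrite /x2 /shears rE eqxx andbF mul0r addr0 x10.
  have x2c c : c != i0 -> x2 c = x c + (x i0 - rest x) * v x c.
    move=> ci; rewrite /x2 /shears rE ci andbT x1c// x10 v1.
    by case: (boolP (H c)) => Hc; rewrite ?mul1r// suppv// !mulr0.
  have rest2 : rest x2 =
      rest x + (x i0 - rest x) * \sum_(j | j != i0) v x j ^+ 2.
    move: x2c; set t := x i0 - rest x => x2c.
    rewrite /rest vv2 mulr_sumr -big_split/=; apply: eq_bigr => j ji.
    by rewrite x2c//; ring.
  have dE : dotp (v x) x = v x i0 * x i0 + rest x by rewrite /dotp (bigD1 i0).
  have nE : sqnorm (v x) = v x i0 ^+ 2 + \sum_(j | j != i0) v x j ^+ 2.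
    by rewrite /sqnorm (bigD1 i0).
  apply/funext => c; rewrite /= -/x1 -/x2 /S3 /upd; case: eqP => [->|/eqP ci].
    rewrite rest2 x20 vv2 dE; case: (v2 x) => [v0|[vi0 n2]].
      rewrite v0 big1 => [|j _]; last by rewrite expr0n.
      by ring.
    have -> : \sum_(j | j != i0) v x j ^+ 2 = 1.
      by apply/eqP; rewrite -(inj_eq (addrI (v x i0 ^+ 2))) -nE n2 vi0 sqrrN expr1n.
    by rewrite vi0; ring.
  rewrite x2c// dE; case: (v2 x) => [v0|[-> _]]; last by ring.
  by rewrite v0 !mulr0 subr0 addr0.
apply: preserves_lebesgue_comp.
  apply: (preserves_lebesgue_shear s0 iid i0 (fun x => 1 + 2 * v x i0) rest) => //.
  - by apply: measurable_funD => //; apply: measurable_funM.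
  - by move=> x; case: (v2 x) => [->|[-> _]]; [left|right]; rewrite /=; ring.
  - by move=> x y; rewrite vupd.
apply: preserves_lebesgue_comp.
  apply: shears_preserve.
  - by rewrite filter_uniq// enum_uniq.
  - by apply/allP => c; rewrite rE => /andP[].
  - by rewrite rE eqxx andbF.
apply: (preserves_lebesgue_shear s0 iid i0 (fun=> 1) (fun x => - rest x)) => //.
- exact: measurable_funN.
- by left.
- by move=> x y; rewrite restupd.
Qed.

End OneReflection.

Section OrthogonalReflections.
Context {J : eqType}.
Variables (H : pred I) (V : J -> E -> I -> R) (g : J -> I).
Hypothesis mV : forall l i, measurable_fun [set: E] (fun x => V l x i).
Hypothesis VH : forall l (x y : E), (forall i, ~~ H i -> x i = y i) -> V l x = V l y.
Hypothesis suppV : forall l x i, ~~ H i -> V l x i = 0.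
Hypothesis Hg : forall l, H (g l).
Hypothesis V2 : forall l x,
  V l x = (fun=> 0) \/ V l x (g l) = -1 /\ sqnorm (V l x) = 2.
Hypothesis Vortho : forall l m x, l != m -> dotp (V l x) (V m x) = 0.

Definition reflections (r : seq J) (x : E) : E :=
  fun c => x c - \sum_(l <- r) dotp (V l x) x * V l x c.

(** Orthogonality of the directions makes the simultaneous correction a composition: reflecting
    along [V m] does not alter the inner product with [V l], and no direction changes because all of
    them vanish outside [H] and read only what lies there. *)
Lemma reflections_preserve (r : seq J) : uniq r ->
  preserves_lebesgue s mu (reflections r) /\
  forall x, sqnorm (reflections r x) = sqnorm x.
Proof.
elim: r => [_|l r IHr /= /andP[lr ur]].
  have -> : reflections [::] = id.
    by apply/funext => x; apply/funext => c; rewrite /reflections big_nil subr0.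
  by split.
have [pr nr] := IHr ur.
pose rl (x : E) : E := fun c => x c - dotp (V l x) x * V l x c.
have -> : reflections (l :: r) = rl \o reflections r.
  apply/funext => x.
  have Vr : V l (reflections r x) = V l x.
    apply: VH => i Hi; rewrite /reflections big1 ?subr0// => m _.
    by rewrite suppV// mulr0.
  apply/funext => c; rewrite /rl /= Vr {2}/reflections dotpBr_sum.
  rewrite [X in _ - (_ - X) * _](_ : _ = 0); last first.
    rewrite big_seq big1// => m mr.
    have ml : l != m by apply: contraNneq lr => ->.
    by have /= -> := Vortho l m x ml; rewrite mulr0.
  by rewrite /reflections big_cons; ring.
split.
  apply: preserves_lebesgue_comp => //.
  apply: (@preserves_lebesgue_reflection H (V l) (g l)) => //; [exact: VH|exact: suppV].
move=> x; transitivity (sqnorm (reflections r x)); last exact: nr.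
rewrite /= /rl; move: (reflections r x) => y.
apply: (sqnorm_reflection (V l y) y).
by case: (V2 l y) => [->|[_ ->]]; [left|right].
Qed.

Lemma reflections_preserve_law (r : seq J) : uniq r ->
  measurable_fun [set: E] (reflections r) /\
  forall A, measurable A -> mu (reflections r @^-1` A) = mu A.
Proof.
move=> /reflections_preserve[pr nr]; split; first by case: pr.
exact: (preserves_lebesgue_isometry (reflections r) pr nr).
Qed.

End OrthogonalReflections.
End Reflections.

(** * Normalization and Gram-Schmidt with possibly dependent vectors *)

Section Normalize.
Context {R : realType} {m : nat}.
Implicit Types (u y : 'cV[R]_m).

(* The zero vector is sent to itself, since [0^-1 = 0]. *)
Definition normalize u : 'cV[R]_m := (norm2 u)^-1 *: u.

Lemma mul_trmxE u y : (u^T *m y) 0 0 = \sum_i u i 0 * y i 0.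
Proof. by rewrite !mxE; apply: eq_bigr => i _; rewrite !mxE. Qed.

Lemma norm2_sqr u : norm2 u ^+ 2 = (u^T *m u) 0 0.
Proof.
rewrite sqr_sqrtr; first by rewrite mul_trmxE; apply: eq_bigr => i _; rewrite expr2.
by apply: sumr_ge0 => i _; rewrite sqr_ge0.
Qed.

Lemma norm2_ge0 u : 0 <= norm2 u. Proof. exact: sqrtr_ge0. Qed.

Lemma norm2_eq0 u : norm2 u = 0 -> u = 0.
Proof.
move=> u0; have := norm2_sqr u; rewrite u0 expr0n/= mul_trmxE => /esym/eqP.
rewrite psumr_eq0 => [/allP h|i _]; last by rewrite -expr2 sqr_ge0.
apply/matrixP => i j; rewrite ord1 mxE; apply/eqP.
by have := h i (mem_index_enum i); rewrite mulf_eq0 orbb.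
Qed.

Lemma normalizeK u : norm2 u *: normalize u = u.
Proof.
have [u0|u0] := eqVneq (norm2 u) 0; first by rewrite u0 scale0r (norm2_eq0 _ u0).
by rewrite scalerA divff// scale1r.
Qed.

Lemma normalize_dotp u : let z := normalize u in
  z = 0 \/ z^T *m z = 1%:M.
Proof.
move=> z; have [u0|u0] := eqVneq (norm2 u) 0.
  by left; rewrite /z /normalize u0 invr0 scale0r.
right; rewrite [LHS]mx11_scalar /z /normalize; congr _%:M.
rewrite [(_ *: u)^T]linearZ/= -scalemxAl -scalemxAr scalerA mxE -norm2_sqr.
by rewrite expr2 mulrACA mulVf// mulr1.
Qed.

(** This identity holds for unit and zero vectors alike, which spares the Gram-Schmidt computations
    a case distinction. *)
Lemma mulmx_normalize u : let z := normalize u in z *m (z^T *m z) = z.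
Proof.
by move=> z; case: (normalize_dotp u) => [|->]; rewrite ?mulmx1// -/z => ->; rewrite mul0mx.
Qed.

End Normalize.

Section GramSchmidt.
Context {R : realType} {m : nat}.
Variable v : nat -> 'cV[R]_m.
Implicit Types (u : 'cV[R]_m).

(* [proj k] is the orthogonal projection onto the orthogonal complement of the span of [v 0, ..., v k.-1]. *)
Fixpoint proj (k : nat) : 'M[R]_m :=
  if k is k'.+1 then
    let z := normalize (proj k' *m v k') in proj k' - z *m z^T
  else 1%:M.

Definition gs (k : nat) : 'cV[R]_m := normalize (proj k *m v k).

Lemma projS k : proj k.+1 = proj k - gs k *m (gs k)^T.
Proof. by []. Qed.

Lemma proj_sym k : (proj k)^T = proj k.
Proof.
elim: k => [|k IHk]; first by rewrite trmx1.
by rewrite projS linearB/= IHk trmx_mul trmxK.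
Qed.

Lemma proj_sum k : proj k = 1%:M - \sum_(l < k) gs l *m (gs l)^T.
Proof.
elim: k => [|k IHk]; first by rewrite big_ord0 subr0.
by rewrite projS IHk big_ord_recr/= opprD addrA.
Qed.

Lemma gs_gs k : gs k *m ((gs k)^T *m gs k) = gs k.
Proof. exact: mulmx_normalize. Qed.

(** The two claims feed each other: idempotence at [k] makes [proj k] fix [gs k], and both together
    give idempotence at [k.+1]. *)
Lemma proj_idem_gs k :
  proj k *m proj k = proj k /\ proj k *m gs k = gs k.
Proof.
elim: k => [|k [IH1 IH2]].
  by split; rewrite ?mulmx1// mul1mx.
have idem : proj k.+1 *m proj k.+1 = proj k.+1.
  have IH3 : (gs k)^T *m proj k = (gs k)^T.
    by rewrite -{2}IH2 trmx_mul proj_sym.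
  rewrite projS mulmxBl !mulmxBr IH1 mulmxA IH2 -mulmxA IH3.
  by rewrite mulmxA -(mulmxA (gs k)) gs_gs subrr subr0.
by split=> //; rewrite /gs /normalize -scalemxAr mulmxA idem.
Qed.

Lemma proj_gs k : proj k *m gs k = gs k.
Proof. by case: (proj_idem_gs k). Qed.

Lemma gs_proj k : (gs k)^T *m proj k = (gs k)^T.
Proof. by rewrite -{2}proj_gs trmx_mul proj_sym. Qed.

Lemma gs_projS k : (gs k)^T *m proj k.+1 = 0.
Proof.
rewrite projS mulmxBr gs_proj mulmxA; apply/eqP; rewrite subr_eq0; apply/eqP.
by rewrite -{1}(gs_gs k) !trmx_mul trmxK.
Qed.

Lemma projS_gs k : proj k.+1 *m gs k = 0.
Proof. by apply: trmx_inj; rewrite trmx_mul proj_sym gs_projS trmx0. Qed.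

(** The vector [proj k *m v k] is a multiple of [gs k], which the rank-one term of [proj k.+1]
    removes; if [v k] depends on its predecessors, both vanish. This is what hides the unrevealed
    part of [X] from the iteration. *)
Lemma projS_vec k : proj k.+1 *m v k = 0.
Proof.
rewrite projS mulmxBl -mulmxA -(gs_proj k) -(mulmxA (gs k)^T).
have -> : proj k *m v k = norm2 (proj k *m v k) *: gs k by rewrite normalizeK.
move: (norm2 _) => a.
by rewrite -[(gs k)^T *m _]scalemxAr -[gs k *m _]scalemxAr gs_gs subrr.
Qed.

(** By [projS_vec] the vector [v k] is the sum of its components along [gs 0, ..., gs k]. A
    vanishing [gs l] contributes zero on both sides. The norm identities for the coefficient vectors
    come from here. *)
Lemma parseval_gs k :
  norm2 (\col_(l < k.+1) ((gs l)^T *m v k) 0 0) = norm2 (v k).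
Proof.
apply/eqP; rewrite -(eqrXn2 (n := 2))// ?norm2_ge0//; apply/eqP.
rewrite !norm2_sqr mul_trmxE.
have -> : (v k)^T *m v k = (v k)^T *m (\sum_(l < k.+1) gs l *m (gs l)^T) *m v k.
  have := projS_vec k; rewrite proj_sum mulmxBl mul1mx => /eqP.
  by rewrite subr_eq0 -mulmxA => /eqP <-.
rewrite mulmx_sumr mulmx_suml summxE; apply: eq_bigr => l _.
have -> : (v k)^T *m (gs l *m (gs l)^T) *m v k =
    ((gs l)^T *m v k)^T *m ((gs l)^T *m v k).
  by rewrite trmx_mul trmxK !mulmxA.
by rewrite mul_trmxE big_ord1 mxE.
Qed.

Definition vspan (k : nat) : {vspace 'cV[R]_m} := <<[seq v l | l <- iota 0 k]>>%VS.

Lemma mem_vspan k l : (l < k)%N -> v l \in vspan k.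
Proof. by move=> lk; apply: memv_span; apply: map_f; rewrite mem_iota. Qed.

Lemma vspan_sub k l u : (k <= l)%N -> u \in vspan k -> u \in vspan l.
Proof.
move=> kl; apply: subvP; apply: sub_span => x /mapP[i + ->].
rewrite mem_iota => /andP[_ ik]; apply: map_f; rewrite mem_iota/=.
exact: leq_trans ik kl.
Qed.

Lemma scale_mulmx11 u (a : 'M[R]_1) : u *m a = a 0 0 *: u.
Proof. by rewrite {1}(mx11_scalar a) mul_mx_scalar. Qed.

Lemma gs_vspan k : gs k \in vspan k.+1.
Proof.
elim/ltn_ind: k => k IHk; rewrite /gs /normalize; apply: memvZ.
rewrite proj_sum mulmxBl mul1mx; apply: memvB; first exact: mem_vspan.
rewrite mulmx_suml; apply: memv_suml => l _.
rewrite -mulmxA scale_mulmx11; apply: memvZ.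
exact: (vspan_sub _ _ _ (leqW (ltn_ord l)) (IHk _ (ltn_ord l))).
Qed.

Lemma proj_vspan k u : u - proj k *m u \in vspan k.
Proof.
rewrite proj_sum mulmxBl mul1mx opprB addrC subrK mulmx_suml.
apply: memv_suml => l _; rewrite -mulmxA scale_mulmx11; apply: memvZ.
exact: (vspan_sub _ _ _ (ltn_ord l) (gs_vspan l)).
Qed.

End GramSchmidt.

(** * The iteration driven by revealed Gaussian vectors, path by path *)

Section ConditionedAMP.
Context {R : realType} {n p : nat}.
Variables (F dF G dG : nat -> R -> R) (beta1 : 'cV[R]_p).

(* The AMP iteration with [X] replaced by what the past iterations reveal of it: the direction functions below see only the Gaussian vectors [phi] and [psi].
   [vK] is the revealed part of [X]; the unrevealed part is [vB *m Y *m vA] for a matrix [Y] independent of the past. *)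
Record revealed := Revealed {
  vA : 'M[R]_p; vB : 'M[R]_n; vK : 'M[R]_(n, p); vs : 'cV[R]_n; vb : 'cV[R]_p }.

Definition rev_f (k : nat) (r : revealed) : 'cV[R]_p := emap (F k) (vb r).

Definition rev_z (k : nat) (r : revealed) : 'cV[R]_p :=
  normalize (vA r *m rev_f k r).

Definition rev_A (k : nat) (r : revealed) : 'M[R]_p :=
  vA r - rev_z k r *m (rev_z k r)^T.

(** The revealed part in the middle of a round: the component along [rev_z] has been read off as
    [phi], the one along [rev_w] is still hidden. *)
Definition rev_K (k : nat) (r : revealed) (phi : 'cV[R]_n) : 'M[R]_(n, p) :=
  vK r + vB r *m phi *m (rev_z k r)^T.

Definition rev_s (k : nat) (r : revealed) (phi : 'cV[R]_n) : 'cV[R]_n :=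
  rev_K k r phi *m rev_f k r - avg n (emap (dF k) (vb r)) *: Gterm G k.-1 (vs r).

Definition rev_g (k : nat) (r : revealed) (phi : 'cV[R]_n) : 'cV[R]_n :=
  emap (G k) (rev_s k r phi).

Definition rev_w (k : nat) (r : revealed) (phi : 'cV[R]_n) : 'cV[R]_n :=
  normalize (vB r *m rev_g k r phi).

Definition rev_step (k : nat) (r : revealed) (phi : 'cV[R]_n) (psi : 'cV[R]_p) :
    revealed :=
  let w := rev_w k r phi in
  let K := rev_K k r phi + w *m (rev_A k r *m psi)^T in
  Revealed (rev_A k r) (vB r - w *m w^T) K (rev_s k r phi)
    (K^T *m rev_g k r phi - avg n (emap (dG k) (rev_s k r phi)) *: rev_f k r).

Fixpoint rev (phi : nat -> 'cV[R]_n) (psi : nat -> 'cV[R]_p) (k : nat) : revealed :=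
  if k is k'.+1 then rev_step k (rev phi psi k') (phi k') (psi k')
  else Revealed 1%:M 1%:M 0 0 beta1.

(** Adaptedness: the state after [k] rounds is a function of the first [k] vectors of each kind. The
    directions of a round thus ignore the slots which that round has yet to overwrite. *)
Lemma eq_rev (phi phi' : nat -> 'cV[R]_n) (psi psi' : nat -> 'cV[R]_p) k :
  (forall j, (j < k)%N -> phi j = phi' j) ->
  (forall j, (j < k)%N -> psi j = psi' j) ->
  rev phi psi k = rev phi' psi' k.
Proof.
elim: k => [//|k IHk] hphi hpsi /=; rewrite hphi// hpsi// IHk//.
- by move=> j jk; apply: hphi; exact: ltnW.
- by move=> j jk; apply: hpsi; exact: ltnW.
Qed.

Section Trajectory.
Variables (phi : nat -> 'cV[R]_n) (psi : nat -> 'cV[R]_p).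
Local Notation st := (rev phi psi).

(** The sequences count from 0 and the rounds from 1: [fseq k] stands for F_{k+1}(beta_{k+1}) and
    [gseq k] for G_{k+1}(s_{k+1}). *)
Definition fseq (k : nat) : 'cV[R]_p := rev_f k.+1 (st k).
Definition gseq (k : nat) : 'cV[R]_n := rev_g k.+1 (st k) (phi k).
Definition zseq (k : nat) : 'cV[R]_p := rev_z k.+1 (st k).
Definition wseq (k : nat) : 'cV[R]_n := rev_w k.+1 (st k) (phi k).

Lemma vA_proj k : vA (st k) = proj fseq k.
Proof.
elim: k => [//|k IHk] /=.
by rewrite /rev_A /rev_z IHk.
Qed.

Lemma vB_proj k : vB (st k) = proj gseq k.
Proof.
elim: k => [//|k IHk] /=.
by rewrite /rev_w IHk.
Qed.

Lemma zseqE k : zseq k = gs fseq k.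
Proof. by rewrite /zseq /rev_z vA_proj. Qed.

Lemma wseqE k : wseq k = gs gseq k.
Proof. by rewrite /wseq /rev_w vB_proj. Qed.

Lemma rev_A_proj k : rev_A k.+1 (st k) = proj fseq k.+1.
Proof. exact: vA_proj k.+1. Qed.

Lemma vK_sum k : vK (st k) = \sum_(j < k)
  (proj gseq j *m phi j *m (zseq j)^T + wseq j *m (proj fseq j.+1 *m psi j)^T).
Proof.
elim: k => [|k IHk]; first by rewrite big_ord0.
by rewrite big_ord_recr/= rev_A_proj /rev_K IHk vB_proj addrA.
Qed.

Lemma rev_K_sum k : rev_K k.+1 (st k) (phi k) =
  \sum_(j < k.+1) proj gseq j *m phi j *m (zseq j)^T +
  \sum_(j < k) wseq j *m (proj fseq j.+1 *m psi j)^T.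
Proof.
rewrite /rev_K vK_sum vB_proj big_split/= [X in _ = X + _]big_ord_recr/=.
by rewrite addrAC.
Qed.

(** Applying [rev_K] to [fseq k] gives projected vectors [proj gseq j *m phi j] with the stated
    coefficients, plus multiples of [wseq j] for [j < k]. Undoing the projections costs vectors in
    the span of earlier [gseq], and the [wseq j] and the memory term lie in [vspan gseq k] too. *)
Lemma rev_s_decomp k :
  vs (st k.+1) - \sum_(j < k.+1) ((gs fseq j)^T *m fseq k) 0 0 *: phi j
    \in vspan gseq k.
Proof.
(* At [k = 0] the span is trivial, and the convention G_0(s_0) = 0 is what makes the memory term
   belong to it. *)
have memG : Gterm G k (vs (st k)) \in vspan gseq k.
  rewrite /Gterm; case: k => [|k]; first exact: mem0v.
  exact: (mem_vspan gseq k.+1 k).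
have -> : vs (st k.+1) =
    rev_K k.+1 (st k) (phi k) *m fseq k -
    avg n (emap (dF k.+1) (vb (st k))) *: Gterm G k (vs (st k)) by [].
rewrite rev_K_sum mulmxDl !mulmx_suml addrAC.
apply: memvB; last exact: memvZ.
rewrite addrAC; apply: memvD; last first.
  apply: memv_suml => j _; rewrite -mulmxA scale_mulmx11; apply: memvZ.
  by rewrite wseqE; exact: (vspan_sub gseq _ _ _ (ltn_ord j) (gs_vspan gseq j)).
rewrite -sumrB; apply: memv_suml => j _.
rewrite -mulmxA scale_mulmx11 -zseqE -scalerBr; apply: memvZ.
rewrite -memvN opprB.
exact: (vspan_sub gseq j k _ (ltn_ord j) (proj_vspan gseq j (phi j))).
Qed.

(** Same argument on the transposed side. The span reaches one index further because [psi j] is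
    projected by [proj fseq j.+1] and the memory term is a multiple of [fseq k]. *)
Lemma rev_b_decomp k :
  vb (st k.+1) - \sum_(j < k.+1) ((gs gseq j)^T *m gseq k) 0 0 *: psi j
    \in vspan fseq k.+1.
Proof.
have -> : vb (st k.+1) = (vK (st k.+1))^T *m gseq k -
    avg n (emap (dG k.+1) (vs (st k.+1))) *: fseq k by [].
rewrite addrAC; apply: memvB; last by apply: memvZ; exact: mem_vspan.
rewrite vK_sum linear_sum/= mulmx_suml -sumrB; apply: memv_suml => j _.
rewrite linearD/= mulmxDl -addrA; apply: memvD.
  rewrite trmx_mul trmxK -mulmxA scale_mulmx11; apply: memvZ.
  rewrite zseqE.
  exact: (vspan_sub fseq _ _ _ (ltn_ord j) (gs_vspan fseq j)).
rewrite trmx_mul trmxK -mulmxA scale_mulmx11 -wseqE -scalerBr; apply: memvZ.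
rewrite -memvN opprB.
exact: (vspan_sub fseq _ _ _ (ltn_ord j) (proj_vspan fseq j.+1 (psi j))).
Qed.

Section Link.
Variables (T : nat) (Y Yh : nat -> 'M[R]_(n, p)).
(* Round [k] replaces [Y k] by [Yh k] (fresh component along [zseq k]), then by [Y k.+1] (fresh component along [wseq k]). *)
Hypothesis Yh_z : forall k, (k < T)%N -> exists u, Yh k = Y k - u *m (zseq k)^T.
Hypothesis Y_phi : forall k, (k < T)%N ->
  Y k *m zseq k *m (zseq k)^T = phi k *m (zseq k)^T.
Hypothesis Y_w : forall k, (k < T)%N -> exists u, Y k.+1 = Yh k - wseq k *m u.
Hypothesis Y_psi : forall k, (k < T)%N ->
  wseq k *m ((wseq k)^T *m Yh k) = wseq k *m (psi k)^T.

(** Split [vA] as [rev_A] plus the rank-one term of [zseq k]. On the latter [Y k] acts through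
    [phi k]; on the former [Y k] and [Yh k] agree, since [rev_A] kills their difference. *)
Lemma revealed_half k : (k < T)%N ->
  vK (st k) + vB (st k) *m Y k *m vA (st k) =
  rev_K k.+1 (st k) (phi k) + vB (st k) *m Yh k *m rev_A k.+1 (st k).
Proof.
move=> kT; have [u ->] := Yh_z k kT.
have -> : vB (st k) *m (Y k - u *m (zseq k)^T) *m rev_A k.+1 (st k) =
    vB (st k) *m Y k *m rev_A k.+1 (st k).
  rewrite (mulmxBr _ (Y k)) mulmxBl -!mulmxA rev_A_proj zseqE gs_projS !mulmx0.
  by rewrite subr0.
have h : vB (st k) *m phi k *m (zseq k)^T =
    vB (st k) *m Y k *m (zseq k *m (zseq k)^T).
  by rewrite -mulmxA -Y_phi// !mulmxA.
rewrite /rev_K /rev_A -/(zseq k) h mulmxBr -addrA; congr (_ + _).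
by rewrite addrC subrK.
Qed.

Lemma revealed_full k : (k < T)%N ->
  rev_K k.+1 (st k) (phi k) + vB (st k) *m Yh k *m rev_A k.+1 (st k) =
  vK (st k.+1) + vB (st k.+1) *m Y k.+1 *m vA (st k.+1).
Proof.
move=> kT; have [u ->] := Y_w k kT.
have BE : vB (st k) = vB (st k.+1) + wseq k *m (wseq k)^T.
  by rewrite /= subrK.
have -> : vB (st k.+1) *m (Yh k - wseq k *m u) = vB (st k.+1) *m Yh k.
  by rewrite mulmxBr mulmxA vB_proj wseqE projS_gs mul0mx subr0.
have -> : vK (st k.+1) = rev_K k.+1 (st k) (phi k) +
    wseq k *m (psi k)^T *m rev_A k.+1 (st k).
  have := rev_A_proj k; set A := rev_A _ _ => AE.
  by rewrite /= -/A trmx_mul AE proj_sym mulmxA.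
by rewrite -Y_psi// BE 2!mulmxDl [X in _ + X]addrC addrA !mulmxA.
Qed.

Lemma amp_rev k : (k <= T)%N ->
  Y 0%N = vK (st k) + vB (st k) *m Y k *m vA (st k) /\
  amp F dF G dG beta1 (Y 0%N) k = (vs (st k), vb (st k)).
Proof.
elim: k => [_|k IHk kT].
  by split=> //; rewrite /= add0r mul1mx mulmx1.
have [XE aE] := IHk (ltnW kT); set X := Y 0%N in XE aE *.
(* Two expressions of the same [X]: the mid-round one serves to compute [s], where [rev_A] kills
   [fseq k]; the end-of-round one serves to compute [beta], where the new [vB] kills [gseq k]. *)
have Xh : X = rev_K k.+1 (st k) (phi k) + vB (st k) *m Yh k *m rev_A k.+1 (st k).
  by rewrite XE revealed_half.
have Xf : X = vK (st k.+1) + vB (st k.+1) *m Y k.+1 *m vA (st k.+1).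
  by rewrite -revealed_full.
split=> //.
have sE : X *m fseq k - avg n (emap (dF k.+1) (vb (st k))) *: Gterm G k (vs (st k))
    = vs (st k.+1).
  rewrite {1}Xh mulmxDl -mulmxA rev_A_proj projS_vec mulmx0 addr0.
  by [].
have -> : amp F dF G dG beta1 X k.+1 =
  let s := X *m fseq k - avg n (emap (dF k.+1) (vb (st k))) *: Gterm G k (vs (st k)) in
  (s, X^T *m emap (G k.+1) s - avg n (emap (dG k.+1) s) *: fseq k).
  by rewrite /= aE.
rewrite sE /=; congr (_, _ - _).
rewrite {1}Xf linearD/= mulmxDl -[X in _ = X]addr0; congr (_ + _).
rewrite !trmx_mul -!mulmxA.
have -> : (vB (st k.+1))^T *m gseq k = 0.
  by rewrite vB_proj proj_sym projS_vec.
by rewrite !mulmx0.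
Qed.

End Link.
End Trajectory.

Lemma eq_zseq (phi phi' : nat -> 'cV[R]_n) (psi psi' : nat -> 'cV[R]_p) k :
  (forall j, (j < k)%N -> phi j = phi' j) ->
  (forall j, (j < k)%N -> psi j = psi' j) ->
  zseq phi psi k = zseq phi' psi' k.
Proof. by move=> hphi hpsi; rewrite /zseq (eq_rev _ _ _ _ _ hphi hpsi). Qed.

(** Here [phi k] itself is read, since [wseq k] is built from s_{k+1}; it is already final when
    [psi k] is exchanged. *)
Lemma eq_wseq (phi phi' : nat -> 'cV[R]_n) (psi psi' : nat -> 'cV[R]_p) k :
  (forall j, (j <= k)%N -> phi j = phi' j) ->
  (forall j, (j < k)%N -> psi j = psi' j) ->
  wseq phi psi k = wseq phi' psi' k.
Proof.
move=> hphi hpsi; rewrite /wseq hphi//.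
by rewrite (eq_rev phi phi' psi psi')// => j jk; rewrite hphi// ltnW.
Qed.

End ConditionedAMP.

(** * Measurability of the nonlinearities, of matrix operations and of the iteration *)

Section AlmostDifferentiable.
Import numFieldNormedType.Exports.
Context {R : realType}.
Implicit Types (f df : R -> R) (S : seq R).

Lemma measurable_seq S : measurable [set x : R | x \in S].
Proof.
elim: S => [|a S IHS].
  by rewrite (_ : [set x | _] = set0)//; apply/seteqP; split.
rewrite (_ : [set x | _] = [set a] `|` [set x | x \in S]).
  exact: measurableU.
apply/seteqP; split=> x /=; first by rewrite in_cons => /predU1P.
by case=> [->|xS]; rewrite in_cons ?eqxx// xS orbT.
Qed.

Lemma open_notin_seq S : open [set x : R | x \notin S].
Proof.
rewrite (_ : [set x | _] = ~` [set x | x \in S]); last first.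
  by apply/seteqP; split=> x /=; move/negP.
apply: closed_openC.
have /accessible_finite_set_closed : accessible_space R.
  by apply: hausdorff_accessible; exact: Rhausdorff.
by apply; exact: finite_seq.
Qed.

(** On the finite set [S] every preimage is finite, hence measurable. *)
Lemma measurable_fun_off_seq f S :
  measurable_fun [set x | x \notin S] f -> measurable_fun [set: R] f.
Proof.
move=> mf; have mS := measurable_seq S.
have mC : measurable [set x : R | x \notin S] by apply: open_measurable; exact: open_notin_seq.
rewrite (_ : [set: R] = [set x | x \in S] `|` [set x | x \notin S]); last first.
  by apply/seteqP; split=> x //= _; case: (boolP (x \in S)); [left|right].
apply/measurable_funU => //; split=> // _ B mB.
apply: countable_measurable => //.
apply: finite_set_countable; apply: sub_finite_set (finite_seq S).
by move=> x [].
Qed.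

Lemma measurable_almost_differentiable f df S :
  (forall x, x \notin S -> is_derive x (1 : R) f (df x)) ->
  measurable_fun [set: R] f.
Proof.
move=> dfS; apply: (measurable_fun_off_seq f S).
apply: open_continuous_measurable_fun; first exact: open_notin_seq.
move=> x; rewrite inE /= => xS.
apply: differentiable_continuous; apply/derivable1_diffP.
by have [] := dfS x xS.
Qed.

(** Off [S] the derivative is the pointwise limit of the difference quotients with steps
    [1 / (k + 1)], each of them measurable. *)
Lemma measurable_almost_derivative f df S :
  (forall x, x \notin S -> is_derive x (1 : R) f (df x)) ->
  measurable_fun [set: R] df.
Proof.
move=> dfS; have mf := measurable_almost_differentiable f df S dfS.
apply: (measurable_fun_off_seq df S).
pose h (k : nat) (x : R) := k.+1%:R * (f (x + k.+1%:R^-1) - f x).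
apply: (@measurable_fun_cvg _ _ _ _ h).
  move=> k; apply: measurable_funTS; apply: measurable_funM => //.
  apply: measurable_funB => //.
  apply: (measurableT_comp mf (g := fun x : R => x + k.+1%:R^-1 : R)).
  exact: measurable_funD.
move=> x xS; have [/= ef fv] := dfS x xS.
have : h0^-1 *: ((f \o shift x) (h0 *: 1) - f x) @[h0 --> 0^'] --> df x.
  by rewrite -fv; exact: ef.
move/cvgr_dnbhsP => /(_ (fun k => k.+1%:R^-1)) hc.
rewrite (_ : h ^~ x = (fun k => (k.+1%:R^-1)^-1 *: ((f \o shift x) (k.+1%:R^-1 *: 1) - f x))).
  apply: hc; split; last exact: cvg_harmonic.
  by move=> k; rewrite invr_neq0.
apply/funext => k; rewrite /h invrK /=; congr (_ * (f _ - _)).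
by rewrite addrC; congr (_ + _); exact/esym/mulr1.
Qed.

End AlmostDifferentiable.

Section MeasurableMatrix.
Context {R : realType} {d : measure_display} {T : measurableType d}.

Definition measurable_mx {m n : nat} (f : T -> 'M[R]_(m, n)) : Prop :=
  forall i j, measurable_fun [set: T] (fun x => f x i j).

Lemma measurable_mx_cst {m n} (A : 'M[R]_(m, n)) : measurable_mx (fun=> A).
Proof. by move=> i j; exact: measurable_cst. Qed.

Lemma measurable_mxD {m n} (f g : T -> 'M[R]_(m, n)) :
  measurable_mx f -> measurable_mx g -> measurable_mx (fun x => f x + g x).
Proof.
move=> mf mg i j; under eq_fun do rewrite mxE.
exact: measurable_funD.
Qed.

Lemma measurable_mxN {m n} (f : T -> 'M[R]_(m, n)) :
  measurable_mx f -> measurable_mx (fun x => - f x).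
Proof.
move=> mf i j; under eq_fun do rewrite mxE.
exact: measurable_funN.
Qed.

Lemma measurable_mxB {m n} (f g : T -> 'M[R]_(m, n)) :
  measurable_mx f -> measurable_mx g -> measurable_mx (fun x => f x - g x).
Proof. by move=> mf mg; apply: measurable_mxD => //; exact: measurable_mxN. Qed.

Lemma measurable_mxZ {m n} (c : T -> R) (f : T -> 'M[R]_(m, n)) :
  measurable_fun [set: T] c -> measurable_mx f ->
  measurable_mx (fun x => c x *: f x).
Proof.
move=> mc mf i j; under eq_fun do rewrite mxE.
exact: measurable_funM.
Qed.

Lemma measurable_mxM {m n p} (f : T -> 'M[R]_(m, n)) (g : T -> 'M[R]_(n, p)) :
  measurable_mx f -> measurable_mx g -> measurable_mx (fun x => f x *m g x).
Proof.
move=> mf mg i j; under eq_fun do rewrite mxE.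
by apply: measurable_sum => k; exact: measurable_funM.
Qed.

Lemma measurable_mx_tr {m n} (f : T -> 'M[R]_(m, n)) :
  measurable_mx f -> measurable_mx (fun x => (f x)^T).
Proof.
by move=> mf i j; under eq_fun do rewrite mxE; exact: mf.
Qed.

Lemma measurable_mx_sum {m n} (J : Type) (r : seq J) (f : J -> T -> 'M[R]_(m, n)) :
  (forall l, measurable_mx (f l)) -> measurable_mx (fun x => \sum_(l <- r) f l x).
Proof.
move=> mf i j; under eq_fun do rewrite summxE.
by apply: measurable_sum => l; exact: mf.
Qed.

Lemma measurable_emap {m} (h : R -> R) (f : T -> 'cV[R]_m) :
  measurable_fun [set: R] h -> measurable_mx f ->
  measurable_mx (fun x => emap h (f x)).
Proof.
move=> mh mf i j; under eq_fun do rewrite mxE.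
exact: (measurableT_comp mh (mf i j)).
Qed.

Lemma measurable_avg {m} (n : nat) (f : T -> 'cV[R]_m) :
  measurable_mx f -> measurable_fun [set: T] (fun x => avg n (f x)).
Proof.
move=> mf; apply: measurable_funM; first exact: measurable_cst.
by apply: measurable_sum => i; exact: mf.
Qed.

Lemma measurable_inv : measurable_fun [set: R] (fun x : R => x^-1).
Proof.
apply: (measurable_fun_off_seq _ [:: 0]).
apply: open_continuous_measurable_fun; first exact: open_notin_seq.
by move=> x; rewrite inE /= inE => x0; exact: inv_continuous.
Qed.

Lemma measurable_normalize {m} (f : T -> 'cV[R]_m) :
  measurable_mx f -> measurable_mx (fun x => normalize (f x)).
Proof.
move=> mf; apply: measurable_mxZ => //.
apply: (measurableT_comp measurable_inv).
apply: (measurableT_comp (continuous_measurable_fun (@sqrt_continuous R))).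
by apply: measurable_sum => i; exact: measurable_funX.
Qed.

End MeasurableMatrix.

Section MeasurableConditionedAMP.
Context {R : realType} {d : measure_display} {T : measurableType d} {n p : nat}.
Variables (F dF G dG : nat -> R -> R) (beta1 : 'cV[R]_p).
Hypothesis mF : forall k, measurable_fun [set: R] (F k.+1).
Hypothesis mdF : forall k, measurable_fun [set: R] (dF k.+1).
Hypothesis mG : forall k, measurable_fun [set: R] (G k).
Hypothesis mdG : forall k, measurable_fun [set: R] (dG k).
Variables (phi : T -> nat -> 'cV[R]_n) (psi : T -> nat -> 'cV[R]_p).
Hypothesis mphi : forall k, measurable_mx (fun x => phi x k).
Hypothesis mpsi : forall k, measurable_mx (fun x => psi x k).
Local Notation st x k := (rev F dF G dG beta1 (phi x) (psi x) k).

Lemma measurable_rev k :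
  [/\ measurable_mx (fun x => vA (st x k)), measurable_mx (fun x => vB (st x k)),
      measurable_mx (fun x => vK (st x k)), measurable_mx (fun x => vs (st x k))
    & measurable_mx (fun x => vb (st x k))] /\
  [/\ measurable_mx (fun x => fseq F dF G dG beta1 (phi x) (psi x) k),
      measurable_mx (fun x => gseq F dF G dG beta1 (phi x) (psi x) k),
      measurable_mx (fun x => zseq F dF G dG beta1 (phi x) (psi x) k)
    & measurable_mx (fun x => wseq F dF G dG beta1 (phi x) (psi x) k)].
Proof.
(* Measurability of the state passes to the quantities computed inside the next round; both the
   induction step and the final claims use this. *)
have half k' : [/\ measurable_mx (fun x => vA (st x k')), measurable_mx (fun x => vB (st x k')),
      measurable_mx (fun x => vK (st x k')), measurable_mx (fun x => vs (st x k'))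
    & measurable_mx (fun x => vb (st x k'))] ->
   let r x := st x k' in
   [/\ measurable_mx (fun x => rev_f F k'.+1 (r x)),
      measurable_mx (fun x => rev_z F k'.+1 (r x)),
      measurable_mx (fun x => rev_K F k'.+1 (r x) (phi x k')),
      measurable_mx (fun x => rev_s F dF G k'.+1 (r x) (phi x k'))
    & measurable_mx (fun x => rev_w F dF G k'.+1 (r x) (phi x k'))].
  move=> [mA mB mK ms mb] r.
  have mf : measurable_mx (fun x => rev_f F k'.+1 (r x)) by exact: measurable_emap.
  have mz : measurable_mx (fun x => rev_z F k'.+1 (r x)).
    by apply: measurable_normalize; exact: measurable_mxM.
  have mK' : measurable_mx (fun x => rev_K F k'.+1 (r x) (phi x k')).
    apply: measurable_mxD => //; apply: measurable_mxM; last exact: measurable_mx_tr.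
    exact: measurable_mxM.
  have ms' : measurable_mx (fun x => rev_s F dF G k'.+1 (r x) (phi x k')).
    apply: measurable_mxB; first exact: measurable_mxM.
    apply: measurable_mxZ; first by apply: measurable_avg; exact: measurable_emap.
    rewrite /Gterm; case: (k'.+1.-1 == 0)%N; first exact: measurable_mx_cst.
    exact: measurable_emap.
  split=> //; apply: measurable_normalize; apply: measurable_mxM => //.
  exact: measurable_emap.
suff main k' : [/\ measurable_mx (fun x => vA (st x k')), measurable_mx (fun x => vB (st x k')),
      measurable_mx (fun x => vK (st x k')), measurable_mx (fun x => vs (st x k'))
    & measurable_mx (fun x => vb (st x k'))].
  split; first exact: main.
  have [mf mz mK ms mw] := half k (main k).
  by split=> //; exact: measurable_emap.
elim: k' => [|k' IHk]; first by split; exact: measurable_mx_cst.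
have [mA mB mK ms mb] := IHk; have [mf mz mK' ms' mw'] := half k' IHk.
have mA' : measurable_mx (fun x => rev_A F k'.+1 (st x k')).
  apply: measurable_mxB => //; apply: measurable_mxM => //; exact: measurable_mx_tr.
have mK'' : measurable_mx (fun x => vK (st x k'.+1)).
  apply: measurable_mxD => //; apply: measurable_mxM => //; apply: measurable_mx_tr.
  exact: measurable_mxM.
split=> //.
  apply: measurable_mxB => //; apply: measurable_mxM => //; exact: measurable_mx_tr.
apply: measurable_mxB.
  apply: measurable_mxM; first exact: measurable_mx_tr.
  exact: measurable_emap.
apply: measurable_mxZ => //.
by apply: measurable_avg; exact: measurable_emap.
Qed.

End MeasurableConditionedAMP.

(** * Exchanging a matrix component with a fresh Gaussian vector *)

Section Swap.
Context {R : realType} {I : finType} {s : R} {mu : probability (prodR I R) R}.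
Hypothesis s0 : s != 0.
Hypothesis iid : iid_law (normal_prob 0 s) mu.
Local Notation E := (prodR I R).

Context {a b : nat}.
Variables (u : 'I_a -> 'I_b -> I) (g : 'I_a -> I).
Hypothesis u_inj : forall i j i' j', u i j = u i' j' -> i = i' /\ j = j'.
Hypothesis g_inj : injective g.
Hypothesis ug : forall i j i', u i j != g i'.

Definition block_mx_of (x : I -> R) : 'M[R]_(a, b) := \matrix_(i, j) x (u i j).
Definition slot_of (x : I -> R) : 'cV[R]_a := \col_i x (g i).

Variable z : E -> 'cV[R]_b.
Hypothesis mz : measurable_mx z.
Hypothesis z01 : forall x, z x = 0 \/ (z x)^T *m z x = 1%:M.
Hypothesis z_off : forall x y : E,
  (forall c, (forall i j, c != u i j) -> (forall i, c != g i) -> x c = y c) ->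
  z x = z y.

Let e (x : E) : R := ((z x)^T *m z x) 0 0.

(** The [i]-th direction carries [z x] on row [i] and [- e x] on slot [i]. For a unit [z x] it has
    squared length 2 and entry -1 at the slot, which is the pivot; writing [e x] instead of 1 makes
    it vanish together with [z x]. *)
Let V (i : 'I_a) (x : E) : I -> R := fun c =>
  \sum_j (c == u i j)%:R * z x j 0 - (c == g i)%:R * e x.

(* If [z x] is a unit vector, this exchanges the component of each row of the block along [z x] with the slot; if [z x = 0] it is the identity. *)
Definition swap : E -> E := reflections V (index_enum 'I_a).

Let eE x : e x = \sum_j z x j 0 * z x j 0.
Proof. exact: mul_trmxE. Qed.

Let dotpV i x y : dotp (V i x) y = \sum_j z x j 0 * y (u i j) - e x * y (g i).
Proof.
rewrite /dotp /V; under eq_bigr do rewrite mulrBl mulr_suml.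
rewrite sumrB exchange_big/=; congr (_ - _).
  apply: eq_bigr => j _; rewrite (bigD1 (u i j))//= eqxx mul1r big1 ?addr0//.
  by move=> c /negPf ->; rewrite !mul0r.
rewrite (bigD1 (g i))//= eqxx mul1r big1 ?addr0//.
by move=> c /negPf ->; rewrite !mul0r.
Qed.

Let V_u i x i' j : V i x (u i' j) = (i' == i)%:R * z x j 0.
Proof.
rewrite /V (negPf (ug _ _ _)) mul0r subr0; case: (eqVneq i' i) => [->|ii'].
  rewrite (bigD1 j)//= eqxx big1 ?addr0// => k kj.
  rewrite (_ : (_ == _) = false) ?mul0r//.
  by apply: contraNF kj => /eqP/u_inj[_ ->].
rewrite mul0r big1// => k _.
rewrite (_ : (_ == _) = false) ?mul0r//.
by apply: contraNF ii' => /eqP/u_inj[-> _].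
Qed.

Let V_g i x i' : V i x (g i') = - ((i' == i)%:R * e x).
Proof.
rewrite /V big1 ?sub0r; first by rewrite (inj_eq g_inj).
by move=> j _; rewrite eq_sym (negPf (ug _ _ _)) mul0r.
Qed.

(** It marks the block and slot coordinates, the only ones that the exchange may move; it plays the
    part of [H] in the reflection lemmas. *)
Let off : pred I := fun c => ~~ ([forall i, forall j, c != u i j] && [forall i, c != g i]).

Let offP c : reflect ((forall i j, c != u i j) /\ (forall i, c != g i)) (~~ off c).
Proof.
rewrite negbK; apply: (iffP andP) => -[h1 h2]; split.
- by move=> i j; move/forallP: h1 => /(_ i)/forallP/(_ j).
- by move=> i; move/forallP: h2.
- by apply/forallP => i; apply/forallP => j; exact: h1.
- by apply/forallP => i; exact: h2.
Qed.

Let V_off i x c : ~~ off c -> V i x c = 0.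
Proof.
move=> /offP[hu hg]; rewrite /V (negPf (hg i)) mul0r subr0.
by rewrite big1// => j _; rewrite (negPf (hu i j)) mul0r.
Qed.

Let dotpVV i m x : dotp (V i x) (V m x) = (i == m)%:R * (e x + e x * e x).
Proof.
rewrite dotpV V_g mulrN opprK mulrDr; congr (_ + _); last by rewrite mulrCA.
rewrite eE mulr_sumr; apply: eq_bigr => j _.
by rewrite V_u mulrCA.
Qed.

Lemma swap_law : measurable_fun [set: E] swap /\
  forall A, measurable A -> mu (swap @^-1` A) = mu A.
Proof.
apply: (reflections_preserve_law s0 iid off V g).
- move=> i c.
  have me : measurable_fun [set: E] e.
    by have := measurable_mxM _ _ (measurable_mx_tr _ mz) mz; exact.
  apply: measurable_funB; last exact: measurable_funM.
  by apply: measurable_sum => j; exact: measurable_funM.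
- move=> i x y xy; suff zE : z x = z y by apply/funext => c; rewrite /V /e zE.
  by apply: z_off => c h1 h2; apply: xy; apply/offP.
- exact: V_off.
- by move=> i; apply: contraT => /offP[_ /(_ i)]; rewrite eqxx.
- move=> i x; have -> : sqnorm (V i x) = dotp (V i x) (V i x).
    by apply: eq_bigr => c _; rewrite expr2.
  rewrite dotpVV eqxx V_g eqxx !mul1r; case: (z01 x) => [zx|zx].
    left; apply/funext => c; rewrite /V /e zx mulmx0 mxE mulr0 subr0.
    by rewrite big1// => j _; rewrite mxE mulr0.
  by right; rewrite /e zx mxE eqxx mulr1.
- by move=> i m x /negPf im; rewrite dotpVV im mul0r.
- exact: index_enum_uniq.
Qed.

Let dotpVE i x : dotp (V i x) x =
  (block_mx_of x *m z x - e x *: slot_of x) i 0.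
Proof.
rewrite dotpV !mxE; congr (_ - _).
by apply: eq_bigr => j _; rewrite mxE mulrC.
Qed.

Lemma swap_block x : exists v, block_mx_of (swap x) = block_mx_of x - v *m (z x)^T.
Proof.
exists (block_mx_of x *m z x - e x *: slot_of x).
apply/matrixP => i j; rewrite !mxE big_ord1 -dotpVE mxE /swap /reflections.
congr (_ - _); rewrite (bigD1 i)//= V_u eqxx mul1r big1 ?addr0//.
by move=> l li; rewrite V_u eq_sym (negPf li) mul0r mulr0.
Qed.

(** For a unit [z x] the new slot is exactly the old block applied to [z x]. The right factor
    [(z x)^T] keeps the identity true when [z x = 0], where the slot is left alone. *)
Lemma swap_slot x :
  block_mx_of x *m z x *m (z x)^T = slot_of (swap x) *m (z x)^T.
Proof.
have -> : slot_of (swap x) =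
    slot_of x + e x *: (block_mx_of x *m z x - e x *: slot_of x).
  apply/matrixP => i j; rewrite ord1 mxE [in RHS]mxE [X in _ = _ + X]mxE.
  rewrite -dotpVE [in RHS]mxE /swap /reflections (bigD1 i)//= V_g eqxx mul1r.
  rewrite big1 ?addr0; first by rewrite mulrN opprK mulrC.
  by move=> l li; rewrite V_g eq_sym (negPf li) mul0r oppr0 mulr0.
case: (z01 x) => zx; first by rewrite zx trmx0 !mulmx0.
by rewrite /e zx mxE eqxx !scale1r addrC subrK.
Qed.

Lemma swap_off x c : (forall i j, c != u i j) -> (forall i, c != g i) ->
  swap x c = x c.
Proof.
move=> hu hg; rewrite /swap /reflections big1 ?subr0// => l _.
by rewrite V_off ?mulr0//; exact/offP.
Qed.

End Swap.

(** * The sequence of exchanges and its link with the iteration *)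

Section Rounds.
Context {R : realType} {n p T : nat}.

(* The coordinates are the entries of [X], followed by [T.+1] slots for vectors of size [n] and [T.+1] slots for vectors of size [p]. *)
Definition coords : finType :=
  (('I_n * 'I_p) + (('I_T.+1 * 'I_n) + ('I_T.+1 * 'I_p)))%type.
Local Notation E := (prodR coords R).

Definition cX (i : 'I_n) (j : 'I_p) : coords := inl (i, j).
(** Transposed indexing of the same entries, so that the exchange along [w] is again a [swap], now
    acting on the rows of [X^T]. *)
Definition cXtr (j : 'I_p) (i : 'I_n) : coords := inl (i, j).
(** [inord k] has value [k] only for [k <= T], whence the bounds in the lemmas that separate
    slots. *)
Definition cphi (k : nat) (i : 'I_n) : coords := inr (inl (inord k, i)).
Definition cpsi (k : nat) (j : 'I_p) : coords := inr (inr (inord k, j)).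

Definition mat_of (x : coords -> R) : 'M[R]_(n, p) := block_mx_of cX x.
Definition phi_of (x : coords -> R) (k : nat) : 'cV[R]_n := slot_of (cphi k) x.
Definition psi_of (x : coords -> R) (k : nat) : 'cV[R]_p := slot_of (cpsi k) x.

Lemma block_cXtr (x : coords -> R) : block_mx_of cXtr x = (mat_of x)^T.
Proof. by apply/matrixP => i j; rewrite !mxE. Qed.

Lemma measurable_phi_of k : measurable_mx (fun x : E => phi_of x k).
Proof.
by move=> i j; under eq_fun do rewrite mxE; exact: measurable_coord.
Qed.

Lemma measurable_psi_of k : measurable_mx (fun x : E => psi_of x k).
Proof.
by move=> i j; under eq_fun do rewrite mxE; exact: measurable_coord.
Qed.

Lemma cphi_neq k j i i' : (j <= T)%N -> (k <= T)%N -> j != k -> cphi j i != cphi k i'.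
Proof.
move=> jT kT; apply: contraNneq => -[/(congr1 val)/= + _].
by rewrite !inordK// => ->.
Qed.

Lemma cpsi_neq k j i i' : (j <= T)%N -> (k <= T)%N -> j != k -> cpsi j i != cpsi k i'.
Proof.
move=> jT kT; apply: contraNneq => -[/(congr1 val)/= + _].
by rewrite !inordK// => ->.
Qed.

Variables (F dF G dG : nat -> R -> R) (beta1 : 'cV[R]_p).
Hypothesis mF : forall k, measurable_fun [set: R] (F k.+1).
Hypothesis mdF : forall k, measurable_fun [set: R] (dF k.+1).
Hypothesis mG : forall k, measurable_fun [set: R] (G k).
Hypothesis mdG : forall k, measurable_fun [set: R] (dG k).

Definition z_of (k : nat) (x : E) : 'cV[R]_p :=
  zseq F dF G dG beta1 (phi_of x) (psi_of x) k.
Definition w_of (k : nat) (x : E) : 'cV[R]_n :=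
  wseq F dF G dG beta1 (phi_of x) (psi_of x) k.

Definition zround (k : nat) : E -> E := swap cX (cphi k) (z_of k).
Definition wround (k : nat) : E -> E := swap cXtr (cpsi k) (w_of k).

Fixpoint rounds (k : nat) (x : E) : E :=
  if k is k'.+1 then wround k' (zround k' (rounds k' x)) else x.

Lemma z_of_off k (x y : E) : (k <= T)%N ->
  (forall c, (forall i j, c != cX i j) -> (forall i, c != cphi k i) -> x c = y c) ->
  z_of k x = z_of k y.
Proof.
move=> kT xy; apply: eq_zseq => j jk; apply/matrixP => i l; rewrite !mxE.
  apply: xy => // i'; apply: cphi_neq => //; last by rewrite ltn_eqF.
  exact: leq_trans (ltnW jk) kT.
exact: xy.
Qed.

Lemma w_of_off k (x y : E) : (k <= T)%N ->
  (forall c, (forall j i, c != cXtr j i) -> (forall j, c != cpsi k j) -> x c = y c) ->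
  w_of k x = w_of k y.
Proof.
move=> kT xy; apply: eq_wseq => j jk; apply/matrixP => i l; rewrite !mxE.
  exact: xy.
apply: xy => // i'; apply: cpsi_neq => //; last by rewrite ltn_eqF.
exact: leq_trans (ltnW jk) kT.
Qed.

Lemma z_of_unit k x : z_of k x = 0 \/ (z_of k x)^T *m z_of k x = 1%:M.
Proof. exact: normalize_dotp. Qed.

Lemma w_of_unit k x : w_of k x = 0 \/ (w_of k x)^T *m w_of k x = 1%:M.
Proof. exact: normalize_dotp. Qed.

Lemma cX_inj i j i' j' : cX i j = cX i' j' -> i = i' /\ j = j'.
Proof. by case=> -> ->. Qed.

Lemma cXtr_inj j i j' i' : cXtr j i = cXtr j' i' -> j = j' /\ i = i'.
Proof. by case=> -> ->. Qed.

Lemma cphi_inj k : injective (cphi k). Proof. by move=> i i' []. Qed.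

Lemma cpsi_inj k : injective (cpsi k). Proof. by move=> i i' []. Qed.

Lemma zround_phi k j x : (j <= T)%N -> (k <= T)%N -> j != k ->
  phi_of (zround k x) j = phi_of x j.
Proof.
move=> jT kT jk; apply/matrixP => i l; rewrite !mxE.
by apply: swap_off => // i'; exact: cphi_neq.
Qed.

Lemma zround_psi k j x : psi_of (zround k x) j = psi_of x j.
Proof. by apply/matrixP => i l; rewrite !mxE; exact: swap_off. Qed.

Lemma wround_phi k j x : phi_of (wround k x) j = phi_of x j.
Proof. by apply/matrixP => i l; rewrite !mxE; exact: swap_off. Qed.

Lemma wround_psi k j x : (j <= T)%N -> (k <= T)%N -> j != k ->
  psi_of (wround k x) j = psi_of x j.
Proof.
move=> jT kT jk; apply/matrixP => i l; rewrite !mxE.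
by apply: swap_off => // i'; exact: cpsi_neq.
Qed.

(** Round [j] is the only one that writes slot [j], so its content is final from then on. *)
Lemma rounds_slots k N j x : (j < k)%N -> (k <= N)%N -> (N <= T)%N ->
  phi_of (rounds N x) j = phi_of (rounds k x) j /\
  psi_of (rounds N x) j = psi_of (rounds k x) j.
Proof.
move=> jk; elim: N => [|N IHN]; first by rewrite leqn0 => /eqP k0; rewrite k0 in jk.
rewrite leq_eqVlt => /predU1P[-> //|]; rewrite ltnS => kN NT.
have [<- <-] := IHN kN (ltnW NT).
have jN : (j < N)%N := leq_trans jk kN.
have jT : (j <= T)%N := leq_trans (ltnW jN) (ltnW NT).
rewrite /= wround_phi wround_psi ?(ltnW NT)// ?ltn_eqF// zround_psi.
by rewrite zround_phi ?(ltnW NT)// ltn_eqF.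
Qed.

(** Directions computed on the fly agree with those computed from the final slots, which lets
    [amp_rev] be used with a single pair of sequences. *)
Lemma z_of_rounds k N x : (k <= N)%N -> (N <= T)%N ->
  z_of k (rounds k x) = z_of k (rounds N x).
Proof.
by move=> kN NT; apply: eq_zseq => j jk; have [] := rounds_slots k N j x jk kN NT.
Qed.

Lemma phi_of_zround k N x : (k < N)%N -> (N <= T)%N ->
  phi_of (zround k (rounds k x)) k = phi_of (rounds N x) k.
Proof.
move=> kN NT; have [-> _] := rounds_slots k.+1 N k x (ltnSn k) kN NT.
by rewrite /= wround_phi.
Qed.

Lemma w_of_rounds k N x : (k < N)%N -> (N <= T)%N ->
  w_of k (zround k (rounds k x)) = w_of k (rounds N x).
Proof.
move=> kN NT.
have kT : (k <= T)%N := leq_trans (ltnW kN) NT.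
apply: eq_wseq => j jk; last first.
  by rewrite zround_psi; have [_ ->] := rounds_slots k N j x jk (ltnW kN) NT.
move: jk; rewrite leq_eqVlt => /predU1P[->|jk]; first exact: phi_of_zround.
have [-> _] := rounds_slots k N j x jk (ltnW kN) NT.
by rewrite zround_phi ?ltn_eqF// (leq_trans (ltnW jk)).
Qed.

(** A deterministic identity for every point [x]: the block and slot identities of the exchanges,
    transposed for [w], are the hypotheses of [amp_rev]. *)
Lemma amp_rounds x k : (k <= T)%N ->
  let r := rev F dF G dG beta1 (phi_of (rounds T x)) (psi_of (rounds T x)) k in
  amp F dF G dG beta1 (mat_of x) k = (vs r, vb r).
Proof.
move=> kT /=.
pose Y l := mat_of (rounds l x); pose Yh l := mat_of (zround l (rounds l x)).
have [] := amp_rev F dF G dG beta1 (phi_of (rounds T x)) (psi_of (rounds T x)) T Y Yh _ _ _ _ k kT => //.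
- move=> l lT; rewrite -/(z_of l _) -z_of_rounds// ?(ltnW lT)//.
  by apply: swap_block => //; exact: cX_inj.
- move=> l lT; rewrite -/(z_of l _) -phi_of_zround// -z_of_rounds// ?(ltnW lT)//.
  by apply: swap_slot => //; [exact: cphi_inj|exact: z_of_unit].
- move=> l lT; rewrite -/(w_of l _) -w_of_rounds//.
  have [] := swap_block cXtr (cpsi l) cXtr_inj (fun _ _ _ => isT) (w_of l)
    (zround l (rounds l x)).
  move=> v; rewrite !block_cXtr => /(congr1 trmx).
  by rewrite linearB/= trmx_mul !trmxK => h; exists v^T.
- move=> l lT; rewrite -/(w_of l _) -w_of_rounds//.
  have [_ ->] := rounds_slots l.+1 T l x (ltnSn l) lT (leqnn T).
  have := swap_slot cXtr (cpsi l) (cpsi_inj l) (fun _ _ _ => isT) (w_of l)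
    (w_of_unit l) (zround l (rounds l x)).
  rewrite block_cXtr => /(congr1 trmx).
  by rewrite !trmx_mul !trmxK.
Qed.

Context {s : R} {mu : probability E R}.
Hypothesis s0 : s != 0.
Hypothesis iid : iid_law (normal_prob 0 s) mu.

Lemma rounds_law k : (k <= T)%N -> measurable_fun [set: E] (rounds k) /\
  forall A, measurable A -> mu (rounds k @^-1` A) = mu A.
Proof.
elim: k => [_|k IHk kT]; first by split; first exact: measurable_id.
have [mr lr] := IHk (ltnW kT).
have [_ [_ _ mz mw]] := measurable_rev F dF G dG beta1 mF mdF mG mdG
  (fun x : E => phi_of x) (fun x : E => psi_of x) measurable_phi_of measurable_psi_of k.
have [mzr lzr] : measurable_fun [set: E] (zround k) /\
    forall A, measurable A -> mu (zround k @^-1` A) = mu A.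
  apply: (swap_law s0 iid) => //.
  - exact: cX_inj.
  - exact: cphi_inj.
  - exact: z_of_unit.
  - by move=> x y; apply: z_of_off; exact: ltnW.
have [mwr lwr] : measurable_fun [set: E] (wround k) /\
    forall A, measurable A -> mu (wround k @^-1` A) = mu A.
  apply: (swap_law s0 iid) => //.
  - exact: cXtr_inj.
  - exact: cpsi_inj.
  - exact: w_of_unit.
  - by move=> x y; apply: w_of_off; exact: ltnW.
have mpre (f : E -> E) A : measurable_fun [set: E] f -> measurable A -> measurable (f @^-1` A).
  by move=> mf mA; rewrite -[X in measurable X]setTI; exact: mf.
split; first exact: (measurableT_comp mwr (measurableT_comp mzr mr)).
move=> A mA.
have mwA := mpre _ _ mwr mA.
have -> : rounds k.+1 @^-1` A = rounds k @^-1` (zround k @^-1` (wround k @^-1` A)).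
  by [].
by rewrite (lr _ (mpre _ _ mzr mwA)) (lzr _ mwA) (lwr _ mA).
Qed.

End Rounds.

(** * Existence and marginals of i.i.d. normal families *)

Section IidNormal.
Context {R : realType}.

(** Induction on [m], taking the product with one more normal line; this supplies the auxiliary
    randomness of the slots. *)
Lemma iid_normal_ord (s : R) (m : nat) :
  exists (d : measure_display) (W : measurableType d) (Q : probability W R)
    (g : 'I_m -> W -> R), (forall i, measurable_fun [set: W] (g i)) /\
    forall B : 'I_m -> set R, (forall i, measurable (B i)) ->
      Q [set w | forall i, B i (g i w)] = (\prod_i normal_prob 0 s (B i))%E.
Proof.
pose N := [the probability (measurableTypeR R) R of normal_prob 0 s].
elim: m => [|m [d [W [Q [g [mg gE]]]]]].
  exists _, (measurableTypeR R), N, (fun _ _ => 0); split=> [[]//|B mB].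
  rewrite big_ord0 -(probability_setT N); congr (N _).
  by apply/seteqP; split=> // x _ [].
exists _, (W * measurableTypeR R)%type, [the probability _ _ of (Q \x N)%E].
exists (fun i w => if unlift ord_max i is Some j then g j w.1 else w.2).
split=> [i|B mB].
  case: (unlift ord_max i) => [j|]; last exact: measurable_snd.
  exact: (measurableT_comp (mg j) measurable_fst).
have mBl j : measurable (B (lift ord_max j)) by exact: mB.
rewrite (_ : [set w | _] =
    [set w | forall j, B (lift ord_max j) (g j w)] `*` B ord_max).
  rewrite /= product_measure1E; last 2 first.
  - exact: (measurable_forall_preimage _ _ _ g (fun j => B (lift ord_max j))).
  - exact: mB.
  rewrite big_ord_recr/= (gE (fun j => B (lift ord_max j)))//; congr (_ * _)%E.
  apply: eq_bigr => j _; congr (normal_prob 0 s (B _)).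
  by apply: val_inj; rewrite /= /bump leqNgt ltn_ord.
apply/seteqP; split=> [[w y] /= h|[w y] /= [h1 h2] i].
  split; last by have := h ord_max; rewrite unlift_none.
  by move=> j; have := h (lift ord_max j); rewrite liftK.
by case: unliftP => [j ->|->].
Qed.

Lemma iid_normal_exists (s : R) (J : finType) :
  exists (d : measure_display) (W : measurableType d) (Q : probability W R)
    (g : J -> W -> R), (forall i, measurable_fun [set: W] (g i)) /\
    forall B : J -> set R, (forall i, measurable (B i)) ->
      Q [set w | forall i, B i (g i w)] = (\prod_i normal_prob 0 s (B i))%E.
Proof.
have [d [W [Q [g [mg gE]]]]] := iid_normal_ord s #|J|.
exists d, W, Q, (fun j => g (enum_rank j)); split=> // B mB.
rewrite big_enum_val -(gE (fun i => B (enum_val i)))//.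
congr (Q _); apply/seteqP; split=> w /= h i.
  by have := h (enum_val i); rewrite enum_valK.
by have := h (enum_rank i); rewrite enum_rankK.
Qed.

Lemma iid_law_sub (N : probability (measurableTypeR R) R) (I J : finType)
    (mu : probability (prodR I R) R) (h : J -> I) (B : J -> set R) :
  iid_law N mu -> injective h -> (forall j, measurable (B j)) ->
  mu [set x | forall j, B j (x (h j))] = (\prod_j N (B j))%E.
Proof.
move=> iid h_inj mB.
(* Coordinates outside the image of [h] get the whole line, of probability 1. *)
pose B' i := if [pick j | h j == i] is Some j then B j else setT.
have B'h j : B' (h j) = B j.
  rewrite /B'; case: pickP => [j' /eqP/h_inj -> //|/(_ j)].
  by rewrite eqxx.
have B'n i : i \notin h @: [set: J]%SET -> B' i = setT.
  rewrite /B'; case: pickP => // j /eqP <- /negP[]; exact: imset_f.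
have -> : [set x : prodR I R | forall j, B j (x (h j))] =
    [set x | forall i, B' i (x i)].
  apply/seteqP; split=> x /= hx; last by move=> j; rewrite -B'h; exact: hx.
  move=> i; case: (boolP (i \in h @: [set: J]%SET)) => [/imsetP[j _ ->]|/B'n -> //].
  by rewrite B'h; exact: hx.
rewrite iid; last by move=> i; rewrite /B'; case: pickP => // j _; exact: mB.
rewrite (bigID (mem (h @: [set: J]%SET)))/= [X in (_ * X)%E]big1 ?mule1; last first.
  by move=> i /B'n ->; exact: probability_setT.
rewrite big_imset/=; last by move=> i j _ _; exact: h_inj.
by under eq_bigl do rewrite inE; apply: eq_bigr => j _; rewrite B'h.
Qed.

Lemma iid_law_coord (N : probability (measurableTypeR R) R) (I : finType)
    (mu : probability (prodR I R) R) (i : I) (A : set R) :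
  iid_law N mu -> measurable A -> mu [set x | A (x i)] = N A.
Proof.
move=> iid mA.
have := iid_law_sub N I unit mu (fun=> i) (fun=> A) iid _ (fun=> mA).
rewrite (big_pred1 tt)//= => <-; last by move=> [] [].
by congr (mu _); apply/seteqP; split=> x /=; [|exact].
Qed.

End IidNormal.

(** * The decomposition on an extended probability space *)

Theorem theorem1 (R : realType) (d : measure_display) (Omega : measurableType d)
  (P : probability Omega R) (n p : nat) (X : Omega -> 'M[R]_(n, p))
  (F dF G dG : nat -> R -> R) (beta1 : 'cV[R]_p) :
  (* i.i.d. N(0, 1/n) entries *)
  mutually_independent P (fun ij : 'I_n * 'I_p => fun w => X w ij.1 ij.2) ->
  (forall (i : 'I_n) (j : 'I_p),
      has_normal_law P 0 (Num.sqrt (n%:R^-1)) (fun w => X w i j)) ->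
  (* F_t (t >= 1), G_t (t >= 0) differentiable except at finitely many points,
     with F_t', G_t' their derivatives there *)
  (forall t : nat, (1 <= t)%N -> exists S : seq R,
      forall x, x \notin S -> is_derive x (1 : R) (F t) (dF t x)) ->
  (forall t : nat, exists S : seq R,
      forall x, x \notin S -> is_derive x (1 : R) (G t) (dG t x)) ->
  (* conclusion, on a probability space extending the one carrying X *)
  exists (d' : measure_display) (Omega' : measurableType d')
         (P' : probability Omega' R) (pi : Omega' -> Omega),
    measurable_fun [set: Omega'] pi /\
    (forall A : set Omega, measurable A -> P' (pi @^-1` A) = P A) /\
    exists (phi : nat -> Omega' -> 'cV[R]_n) (psi : nat -> Omega' -> 'cV[R]_p),
      (* phi_1..phi_T, psi_1..psi_T (T = min(n,p)): all entries independent N(0,1/n) *)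
      mutually_independent P'
        (fun c : ('I_(minn n p) * 'I_n) + ('I_(minn n p) * 'I_p) => fun w =>
           match c with
           | inl ki => phi (ki.1).+1 w ki.2 0
           | inr kj => psi (kj.1).+1 w kj.2 0
           end) /\
      (forall (k : 'I_(minn n p)) (i : 'I_n),
          has_normal_law P' 0 (Num.sqrt (n%:R^-1)) (fun w => phi k.+1 w i 0)) /\
      (forall (k : 'I_(minn n p)) (j : 'I_p),
          has_normal_law P' 0 (Num.sqrt (n%:R^-1)) (fun w => psi k.+1 w j 0)) /\
      forall t : nat, (1 <= t <= minn n p)%N ->
        exists (gam alp : Omega' -> 'cV[R]_t) (xi : Omega' -> 'cV[R]_n)
               (zeta : Omega' -> 'cV[R]_p),
          (forall k : 'I_t, measurable_fun [set: Omega'] (fun w => gam w k 0)) /\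
          (forall k : 'I_t, measurable_fun [set: Omega'] (fun w => alp w k 0)) /\
          (forall i : 'I_n, measurable_fun [set: Omega'] (fun w => xi w i 0)) /\
          (forall j : 'I_p, measurable_fun [set: Omega'] (fun w => zeta w j 0)) /\
          {ae P', forall w,
            let Xw := X (pi w) in
            amp_s F dF G dG beta1 Xw t = \sum_(k < t) gam w k 0 *: phi k.+1 w + xi w /\
            amp_beta F dF G dG beta1 Xw t.+1
              = \sum_(k < t) alp w k 0 *: psi k.+1 w + zeta w /\
            norm2 (gam w) = norm2 (emap (F t) (amp_beta F dF G dG beta1 Xw t)) /\
            norm2 (alp w) = norm2 (emap (G t) (amp_s F dF G dG beta1 Xw t)) /\
            xi w \in <<[seq emap (G k) (amp_s F dF G dG beta1 Xw k) | k <- iota 1 t.-1]>>%VS /\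
            zeta w \in <<[seq emap (F k) (amp_beta F dF G dG beta1 Xw k) | k <- iota 1 t]>>%VS}.
Proof.
move=> Xind Xlaw dF_ dG_.
(* If [n] or [p] is 0, no [t] is admissible and both families are empty, so the original space
   serves. Otherwise [n > 0] makes the standard deviation [s] nonzero. *)
have [T0|Tgt0] := posnP (minn n p).
  have no (c : ('I_(minn n p) * 'I_n) + ('I_(minn n p) * 'I_p)) : False.
    by case: c => -[[k]]; rewrite T0.
  exists d, Omega, P, id; split; first exact: measurable_id.
  split=> //; exists (fun _ _ => 0), (fun _ _ => 0).
  split; first move=> B _.
    rewrite big1 => [|c]; last by case: (no c).
    rewrite -(probability_setT P); congr (P _).
    by apply/seteqP; split=> // w _ c; case: (no c).
  split; first by move=> k i; case: (no (inl (k, i))).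
  split; first by move=> k j; case: (no (inr (k, j))).
  by move=> t; rewrite T0 => /andP[t0]; rewrite leqNgt t0.
have n0 : n != 0%N by apply: contraTneq Tgt0 => ->; rewrite min0n.
set s := Num.sqrt (n%:R^-1) in Xlaw *.
have s0 : s != 0.
  by rewrite gt_eqF// sqrtr_gt0 invr_gt0 ltr0n lt0n.
have mF k : measurable_fun [set: R] (F k.+1).
  by have [S /measurable_almost_differentiable] := dF_ k.+1 isT.
have mdF k : measurable_fun [set: R] (dF k.+1).
  by have [S /measurable_almost_derivative] := dF_ k.+1 isT.
have mG k : measurable_fun [set: R] (G k).
  by have [S /measurable_almost_differentiable] := dG_ k.
have mdG k : measurable_fun [set: R] (dG k).
  by have [S /measurable_almost_derivative] := dG_ k.
set T := minn n p in Tgt0 *.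
pose J : finType := (('I_T.+1 * 'I_n) + ('I_T.+1 * 'I_p))%type.
have [d2 [W [Q [g [mg gE]]]]] := iid_normal_exists s J.
pose P' := [the probability _ _ of (P \x Q)%E].
(* The entries of [X] and independent auxiliary Gaussians are gathered into one point; its law [mu]
   is i.i.d. normal, and [rounds] preserves it. *)
pose S0 (w : Omega * W) : prodR (@coords n p T) R := fun c =>
  match c with inl ij => X w.1 ij.1 ij.2 | inr j => g j w.2 end.
have mX (ij : 'I_n * 'I_p) : measurable_fun [set: Omega] (fun w => X w ij.1 ij.2).
  by have [] := Xlaw ij.1 ij.2.
have mS0 : measurable_fun [set: Omega * W] S0.
  apply: measurable_tofun => -[ij|j] /=.
    exact: (measurableT_comp (mX ij) measurable_fst).
  exact: (measurableT_comp (mg j) measurable_snd).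
have [mu muE] := pushforward_probability _ _ _ _ P' S0 mS0.
have iid : iid_law (normal_prob 0 s) mu.
  move=> B mB; rewrite muE.
  have -> : S0 @^-1` [set x | forall c, B c (x c)] =
      [set w | forall ij : 'I_n * 'I_p, B (inl ij) (X w ij.1 ij.2)] `*`
      [set w | forall j : J, B (inr j) (g j w)].
    apply/seteqP; split=> [[w v] /= h|[w v] /= [h1 h2] [ij|j]].
    - by split=> [ij|j]; [exact: (h (inl ij))|exact: (h (inr j))].
    - exact: h1.
    - exact: h2.
  rewrite /P' /= product_measure1E; last 2 first.
  - exact: (measurable_forall_preimage _ _ _ (fun ij w => X w ij.1 ij.2) (fun ij => B (inl ij))).
  - exact: (measurable_forall_preimage _ _ _ g (fun j => B (inr j))).
  rewrite big_sumType/= (gE (fun j => B (inr j)))//; congr (_ * _)%E.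
  rewrite (Xind (fun ij => B (inl ij)))//; apply: eq_bigr => ij _.
  by have [_ ->] := Xlaw ij.1 ij.2.
have [mr lr] := rounds_law F dF G dG beta1 mF mdF mG mdG s0 iid T (leqnn T).
pose r (w : Omega * W) := rounds F dF G dG beta1 T (S0 w).
have rlaw A : measurable A -> P' (r @^-1` A) = mu A.
  by move=> mA; rewrite -(lr A mA).
have mrS0 : measurable_fun [set: Omega * W] r by exact: (measurableT_comp mr mS0).
have mphi k : measurable_mx (fun w => phi_of (r w) k).
  by move=> i j; exact: (measurableT_comp (measurable_phi_of k i j) mrS0).
have mpsi k : measurable_mx (fun w => psi_of (r w) k).
  by move=> i j; exact: (measurableT_comp (measurable_psi_of k i j) mrS0).
have coord_law c A : measurable A -> P' [set w | A (r w c)] = normal_prob 0 s A.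
  move=> mA; rewrite -(iid_law_coord _ _ _ c A iid mA) -rlaw//.
  by rewrite -[X in measurable X]setTI; exact: measurable_coord.
have mcoord c : measurable_fun [set: Omega * W] (fun w => r w c).
  exact: (measurableT_comp (measurable_coord c) mrS0).
(* The vectors of the conclusion count from 1 and the slots from 0; index 0 gets the default value
   0. *)
pose phi k w := if k is k'.+1 then phi_of (r w) k' else 0.
pose psi k w := if k is k'.+1 then psi_of (r w) k' else 0.
exists _, (Omega * W)%type, P', fst; split; first exact: measurable_fst.
split.
  move=> A mA; rewrite (_ : fst @^-1` A = A `*` setT).
    rewrite /P' /= product_measure1E// -[RHS]mule1; congr (_ * _)%E.
    exact: probability_setT.
  by apply/seteqP; split=> [[w v]|[w v]] //= [].
exists phi, psi; split.
  (* The entries of [phi] and [psi] are distinct coordinates of [r w], so their joint law is a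
     marginal of [mu]. *)
  pose h (c : ('I_T * 'I_n) + ('I_T * 'I_p)) : @coords n p T :=
    match c with inl ki => cphi ki.1 ki.2 | inr kj => cpsi kj.1 kj.2 end.
  have h_inj : injective h.
    have inordK_ (k : 'I_T) : (inord k : 'I_T.+1) = k :> nat.
      by rewrite inordK// ltnS ltnW.
    case=> [[k i]|[k i]] [[k' i']|[k' i']] //= -[/(congr1 val)/=];
      by rewrite !inordK_ => /val_inj -> ->.
  have YE w (c : ('I_T * 'I_n) + ('I_T * 'I_p)) : match c with
      | inl ki => phi (ki.1).+1 w ki.2 0
      | inr kj => psi (kj.1).+1 w kj.2 0
      end = r w (h c) by case: c => -[k i]; rewrite /= mxE.
  move=> B mB; transitivity (\prod_c normal_prob 0 s (B c))%E.
    rewrite -(iid_law_sub _ _ _ mu h B iid h_inj mB) -rlaw; last first.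
      apply: (measurable_forall_preimage _ (prodR (@coords n p T) R) _
        (fun c x => x (h c)) B) => // c; exact: measurable_coord.
    by congr (P' _); apply/seteqP; split=> w /= hw c; have := hw c; rewrite YE.
  apply: eq_bigr => c _; rewrite -(coord_law (h c))//.
  by congr (P' _); apply/seteqP; split=> w /=; rewrite YE.
split.
  move=> k i; split.
    by rewrite (_ : (fun w => _) = (fun w => r w (cphi k i)))//; apply/funext => w; rewrite /= mxE.
  move=> A mA; rewrite -(coord_law (cphi k i))//.
  by congr (P' _); apply/seteqP; split=> w /=; rewrite mxE.
split.
  move=> k i; split.
    by rewrite (_ : (fun w => _) = (fun w => r w (cpsi k i)))//; apply/funext => w; rewrite /= mxE.
  move=> A mA; rewrite -(coord_law (cpsi k i))//.
  by congr (P' _); apply/seteqP; split=> w /=; rewrite mxE.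
(* From here on the iteration index of the statement is [t.+1]. *)
case=> [//|t] /andP[_ tT].
pose st w k := rev F dF G dG beta1 (phi_of (r w)) (psi_of (r w)) k.
pose fs w := fseq F dF G dG beta1 (phi_of (r w)) (psi_of (r w)).
pose ws w := gseq F dF G dG beta1 (phi_of (r w)) (psi_of (r w)).
have mrev k := measurable_rev F dF G dG beta1 mF mdF mG mdG _ _ mphi mpsi k.
pose gam w : 'cV[R]_t.+1 := \col_(l < t.+1) ((gs (fs w) l)^T *m fs w t) 0 0.
pose alp w : 'cV[R]_t.+1 := \col_(l < t.+1) ((gs (ws w) l)^T *m ws w t) 0 0.
(* The residuals are defined as what the sums leave over, so the two decompositions are immediate
   and the content lies in the span memberships. *)
pose xi w := vs (st w t.+1) - \sum_(l < t.+1) gam w l 0 *: phi l.+1 w.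
pose zeta w := vb (st w t.+1) - \sum_(l < t.+1) alp w l 0 *: psi l.+1 w.
have mgam (l : 'I_t.+1) : measurable_fun [set: Omega * W] (fun w => gam w l 0).
  under eq_fun do rewrite mxE -zseqE.
  have [_ [_ _ mz _]] := mrev l; have [_ [mf _ _ _]] := mrev t.
  by apply: (measurable_mxM _ _ (measurable_mx_tr _ mz) mf).
have malp (l : 'I_t.+1) : measurable_fun [set: Omega * W] (fun w => alp w l 0).
  under eq_fun do rewrite mxE -wseqE.
  have [_ [_ _ _ mw]] := mrev l; have [_ [_ mg' _ _]] := mrev t.
  by apply: (measurable_mxM _ _ (measurable_mx_tr _ mw) mg').
have mxi : measurable_mx xi.
  apply: measurable_mxB; first by have [[_ _ _ +]] := mrev t.+1.
  by apply: measurable_mx_sum => l; apply: measurable_mxZ => //; exact: mphi.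
have mzeta : measurable_mx zeta.
  apply: measurable_mxB; first by have [[_ _ _ _ +]] := mrev t.+1.
  by apply: measurable_mx_sum => l; apply: measurable_mxZ => //; exact: mpsi.
exists gam, alp, xi, zeta; split=> //; split=> //; split; first by move=> i; exact: mxi.
split; first by move=> j; exact: mzeta.
(* The identities hold at every point, since [amp_rounds] is a pathwise statement. *)
apply: aeW => w; set Xw := X (fst w).
have XwE : mat_of (S0 w) = Xw by apply/matrixP => i j; rewrite mxE.
have aE k : (k <= T)%N -> amp F dF G dG beta1 Xw k = (vs (st w k), vb (st w k)).
  by move=> kT; rewrite -XwE amp_rounds.
have fsE k : (k < T)%N -> emap (F k.+1) (amp_beta F dF G dG beta1 Xw k.+1) = fs w k.
  by move=> kT; rewrite /amp_beta aE// ltnW.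
have wsE k : (k < T)%N -> emap (G k.+1) (amp_s F dF G dG beta1 Xw k.+1) = ws w k.
  by move=> kT; rewrite /amp_s aE.
have lT (l : nat) : (l <= t)%N -> (l < T)%N by move=> lt; exact: leq_ltn_trans tT.
split.
  have -> : amp_s F dF G dG beta1 Xw t.+1 = vs (st w t.+1) by rewrite /amp_s aE.
  by rewrite [RHS]addrC subrK.
split.
  have -> : amp_beta F dF G dG beta1 Xw t.+2 = vb (st w t.+1).
    by rewrite /amp_beta aE.
  by rewrite [RHS]addrC subrK.
rewrite fsE// wsE//; split; first exact: parseval_gs.
split; first exact: parseval_gs.
split.
  rewrite (_ : [seq _ | k <- _] = [seq ws w l | l <- iota 0 t]).
    rewrite /xi; under eq_bigr do rewrite mxE.
    exact: rev_s_decomp.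
  rewrite (iotaDl 1 0 t) -map_comp; apply/eq_in_map => l.
  by rewrite mem_iota => /andP[_ lt] /=; rewrite wsE// lT// ltnW.
rewrite (_ : [seq _ | k <- _] = [seq fs w l | l <- iota 0 t.+1]).
  rewrite /zeta; under eq_bigr do rewrite mxE.
  exact: rev_b_decomp.
rewrite (iotaDl 1 0 t.+1) -map_comp; apply/eq_in_map => l.
by rewrite mem_iota => /andP[_ lt] /=; rewrite fsE// lT.
Qed.
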